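(* Let $X$ be a homogeneous vector field of degree $d$ on $\mathbb{P}^2_{\mathbb{C}}$ and let $n$ be a positive integer. For each $i$ let $n_i(X)$ denote the number of irreducible algebraic curves of degree $i$ in $\mathbb{P}^2_{\mathbb{C}}$ that are invariant by $X$. If $X$ does not have a first integral of degree $\le n$, then $$\sum_{i=1}^{n} i\cdot n_i(X)\ \le\ \frac{d(n^4+6n^3+11n^2+6n)-n^4-2n^3+n^2+2n}{8}.$$
   Context: A homogeneous vector field $X$ of degree $d$ on $\mathbb{P}^2_{\mathbb{C}}$ is represented by a vector field $X=A\frac{\partial}{\partial x}+B\frac{\partial}{\partial y}+C\frac{\partial}{\partial z}$ on $\mathbb{C}^3$ with $A,B,C$ homogeneous polynomials of degree $d$, inducing via the radial projection a field of directions on $\mathbb{P}^2_{\mathbb{C}}$ (so $X$ is not a multiple of the radial field $R=x\frac{\partial}{\partial x}+y\frac{\partial}{\partial y}+z\frac{\partial}{\partial z}$). An algebraic curve with equation $F=0$, $F$ a nonzero homogeneous polynomial, is invariant by $X$ if $X(F)=L_F F$ for some polynomial $L_F$. A first integral of degree $e$ is a non-constant rational function $P/Q$, with $P,Q$ coprime homogeneous polynomials in $x,y,z$ of degree $e$, such that $X(P/Q)=0$. *)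

(* Defs.v *)
From HB Require Import structures.
From mathcomp Require Import all_boot all_order all_algebra.
From mathcomp Require Import finmap.
From mathcomp Require Import mpoly complex.
From mathcomp Require Import boolp classical_sets cardinality reals.
Set Implicit Arguments.
Unset Strict Implicit.
Unset Printing Implicit Defensive.
Import GRing.Theory.

Local Open Scope ring_scope.

Section PlaneVectorFields.
Variable K : fieldType.
Implicit Types (F G P Q L : {mpoly K[3]}) (X : 'I_3 -> {mpoly K[3]}).

(* The components X 0, X 1, X 2 are the coefficients A, B, C of the vector
   field on the affine 3-space, and 'X_0, 'X_1, 'X_2 are x, y, z. *)
Definition vf_apply X F : {mpoly K[3]} := \sum_(i < 3) X i * F^`M(i).

(* Last condition: X is not a multiple of the radial field. *)
Definition homogeneous_vf (d : nat) X : Prop :=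
  (forall i, X i \is d.-homog) /\
  ~ (exists G, forall i, X i = G * 'X_i).

Definition mpoly_frac P Q : {fraction {mpoly K[3]}} :=
  @tofrac {mpoly K[3]} P / @tofrac {mpoly K[3]} Q.

(* X (P / Q), by the quotient rule. *)
Definition vf_apply_frac X P Q : {fraction {mpoly K[3]}} :=
  mpoly_frac (vf_apply X P * Q - P * vf_apply X Q) (Q ^+ 2).

(* multinomials has no divisibility relation; the units of {mpoly K[3]} are
   the nonzero constants. *)
Definition coprime_mpoly P Q : Prop :=
  forall G, (exists P', P = G * P') -> (exists Q', Q = G * Q') ->
    G \is a GRing.unit.

Definition first_integral X (e : nat) P Q : Prop :=
  [/\ P \is e.-homog, Q \is e.-homog, Q != 0 & coprime_mpoly P Q] /\
  (forall c : K, mpoly_frac P Q <> @tofrac {mpoly K[3]} c%:MP) /\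
  vf_apply_frac X P Q = 0.

Definition has_first_integral X (e : nat) : Prop :=
  exists P Q, first_integral X e P Q.

Definition irreducible_mpoly F : Prop :=
  [/\ F != 0, F \isn't a GRing.unit &
      forall P Q, F = P * Q -> P \is a GRing.unit \/ Q \is a GRing.unit].

(* A point of the projective plane is a line through the origin of K^3. *)
Definition is_point (p : {vspace 'rV[K]_3}) : Prop := \dim p = 1%N.

Definition zero_locus F : set {vspace 'rV[K]_3} :=
  [set p | is_point p /\ forall v, v \in p -> F.@[fun i => v 0 i] = 0]%classic.

Definition invariant_eq X F : Prop := exists L, vf_apply X F = L * F.

(* The irreducible curves of degree i invariant by X, as sets of points: two
   equations of the same curve are counted once. *)
Definition invariant_curves X (i : nat) : set (set {vspace 'rV[K]_3}) :=
  [set Z | exists F, [/\ F \is i.-homog, irreducible_mpoly F,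
                         invariant_eq X F & Z = zero_locus F]]%classic.

(* Meaningful only when invariant_curves X i is finite: fset_set sends an
   infinite set to the empty one. *)
Definition nb_invariant_curves X (i : nat) : nat :=
  #|` fset_set (invariant_curves X i)|.

End PlaneVectorFields.

(* Main.v *)
Require Import Defs.
From HB Require Import structures.
From mathcomp Require Import all_boot all_order all_algebra.
From mathcomp Require Import perm.
From mathcomp Require Import finmap.
From mathcomp Require Import mpoly complex.
From mathcomp Require Import boolp classical_sets cardinality reals.
From mathcomp Require Import ring zify.
Set Implicit Arguments.
Unset Strict Implicit.
Unset Printing Implicit Defensive.
Import GRing.Theory Num.Theory.

Local Open Scope ring_scope.

(** The proof compares invariant curves with the extactic curve of order n.
    Let v_1, ..., v_N be the monomials of degree n in x, y, z, where
    N = (n + 1)(n + 2) / 2, and let E be the determinant of the matrix of the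
    X^r(v_j), 0 <= r < N. It is a form of degree
    sum_(r < N) (n + r (d - 1)), which is the bound to be proved.

    An invariant curve P = 0 of degree at most n divides E: a multiple of P is
    a combination of the v_j, and all its images under the powers of X are
    multiples of P ([invariant_divides_extactic]). Distinct irreducible curves
    have non-associated equations, and polynomial rings are factorial
    ([factorial_ring_mpoly]), so if E is not 0 the product of the equations of
    all the irreducible invariant curves of degree at most n divides E, and
    the sum of their degrees is at most the degree of E
    ([invariant_curves_bound]).

    It remains to see that E = 0 yields a first integral of degree at most n.
    By the Wronskian criterion ([wronskian_dependent]) the v_j are then
    linearly dependent over the field k of rational functions killed by X.
    In other words there is a nonzero form G over k, of degree m at most n,
    which vanishes at the generic point p = (x, y, z). Choose m minimal. Then
    G is irreducible, and X G, where X acts on the variables q of G and leaves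
    its coefficients fixed, vanishes at p as well. If G did not divide X G,
    eliminating a variable would give an equation for x / y over k; then x / y
    would be algebraic over the constants, hence constant, and would be a first
    integral of degree 1. So X G = L G ([minimal_relation_invariant]).

    After clearing denominators and common factors, G becomes a polynomial
    in p and q with X G = L G. As X acts on q only, the degree in p of X G is at
    most that of G, so L does not depend on p
    ([relation_constant_cofactor]). Therefore the coefficients of the
    monomials in p are forms in q of degree m that share the cofactor L. If
    they were all proportional, G would be a product T(p) g(q) and could not
    vanish at q = p; so two of them have a nonconstant quotient, which is a
    first integral of degree at most m ([no_relation]). *)

(** * Divisibility and factorial rings *)

Section Divisibility.
Variable A : idomainType.
Implicit Types a b c p : A.

Definition divides a b := exists c, b = c * a.

Definition prime_elt p :=
  [/\ p != 0, p \isn't a GRing.unit &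
      forall a b, divides p (a * b) -> divides p a \/ divides p b].

Definition irreducible_elt a :=
  [/\ a != 0, a \isn't a GRing.unit &
      forall b c, a = b * c -> b \is a GRing.unit \/ c \is a GRing.unit].

(** The index is the number of prime factors. It is additive on products and
    vanishes exactly on units, which makes it an induction measure. A ring is factorial when its nonzero
    elements are products of primes; uniqueness is a consequence. *)
Inductive prime_product : nat -> A -> Prop :=
| PrimeProductUnit u : u \is a GRing.unit -> prime_product 0 u
| PrimeProductMul k p a :
    prime_elt p -> prime_product k a -> prime_product k.+1 (p * a).

Lemma divides0 a : divides a 0.
Proof. by exists 0; rewrite mul0r. Qed.

Lemma divides_refl a : divides a a.
Proof. by exists 1; rewrite mul1r. Qed.

Lemma divides_mull a b c : divides a c -> divides a (b * c).
Proof. by case=> x ->; exists (b * x); rewrite mulrA. Qed.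

Lemma divides_mulr a b c : divides a c -> divides a (c * b).
Proof. by rewrite mulrC; apply: divides_mull. Qed.

Lemma divides_trans b a c : divides a b -> divides b c -> divides a c.
Proof. by move=> ab [x ->]; apply: divides_mull. Qed.

Lemma dividesD a b c : divides a b -> divides a c -> divides a (b + c).
Proof. by case=> x -> [y ->]; exists (x + y); rewrite mulrDl. Qed.

Lemma dividesB a b c : divides a b -> divides a c -> divides a (b - c).
Proof. by case=> x -> [y ->]; exists (x - y); rewrite mulrBl. Qed.

Lemma divides_unitl u a b :
  u \is a GRing.unit -> divides a b -> divides (u * a) b.
Proof. by move=> uu [x ->]; exists (x / u); rewrite mulrA mulrVK. Qed.

Lemma divides_unitr u a b :
  u \is a GRing.unit -> divides a (u * b) -> divides a b.
Proof.
by move=> uu [x e]; exists (u^-1 * x); rewrite -mulrA -e mulKr.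
Qed.

(** Each prime of the product goes to one of the two factors: this is the
    uniqueness of factorizations, in the form in which it is used. *)
Lemma prime_product_split k a b c : prime_product k a -> a = b * c ->
  exists i j, [/\ (i + j)%N = k, prime_product i b & prime_product j c].
Proof.
move=> H; elim: H b c => {k a} [u uu | k p a pp _ IH] b c e.
  exists 0%N, 0%N; move: uu; rewrite e unitrM => /andP[ub uc].
  by split=> //; constructor.
have [p0 _ pP] := pp.
have [[x bE]|[x cE]] : divides p b \/ divides p c.
- by apply: pP; rewrite -e; apply/divides_mulr/divides_refl.
- have [|i [j [ij Hi Hj]]] := IH x c.
    by apply: (mulfI p0); rewrite e bE mulrCA !mulrA.
  exists i.+1, j; split=> //; first by rewrite addSn ij.
  by rewrite bE mulrC; constructor.
have [|i [j [ij Hi Hj]]] := IH b x.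
  by apply: (mulfI p0); rewrite e cE mulrA mulrC.
exists i, j.+1; split=> //; first by rewrite addnS ij.
by rewrite cE mulrC; constructor.
Qed.

Lemma prime_product_mul i j b c :
  prime_product i b -> prime_product j c -> prime_product (i + j) (b * c).
Proof.
move=> H; elim: H c j => {i b} [u uu | k p a pp _ IH] c j Hc.
  elim: Hc => {j c} [v vv | k p a pp _ IH].
    by constructor; rewrite unitrM uu.
  by rewrite mulrCA add0n; constructor.
by rewrite -mulrA addSn; constructor=> //; apply: IH.
Qed.

Lemma prime_elt_unit u p :
  u \is a GRing.unit -> prime_elt p -> prime_elt (u * p).
Proof.
move=> uu [p0 pu pP]; split.
- by rewrite mulf_neq0 //; apply: contraTneq uu => ->; rewrite unitr0.
- by rewrite unitrM uu.
move=> a b [c e]; have /pP[H|H] : divides p (a * b).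
- by exists (c * u); rewrite e mulrA.
- by left; apply: divides_unitl.
- by right; apply: divides_unitl.
Qed.

Definition factorial_ring := forall a, a != 0 -> exists k, prime_product k a.

(** An irreducible product of primes has a single prime factor. *)
Lemma irreducible_prime a : factorial_ring -> irreducible_elt a -> prime_elt a.
Proof.
move=> fA [a0 au aI]; have [k H] := fA _ a0.
case: H au aI => {k} [u uu /negP//|k p b pp _ _ /(_ _ _ erefl)[up|ub]].
  by case: pp => _; rewrite up.
by rewrite mulrC; apply: prime_elt_unit.
Qed.

Lemma not_irreducible a : a != 0 -> a \isn't a GRing.unit ->
  ~ irreducible_elt a ->
  exists b c, [/\ a = b * c, b \isn't a GRing.unit & c \isn't a GRing.unit].
Proof.
move=> a0 au nI; apply: contrapT => H; apply: nI; split=> // b c e.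
have [|nb] := boolP (b \is a GRing.unit); first by left.
have [|nc] := boolP (c \is a GRing.unit); first by right.
by case: H; exists b, c.
Qed.

End Divisibility.

Section DivisibilityMorphism.
Variables (A B : idomainType) (f : {rmorphism A -> B}) (g : {rmorphism B -> A}).
Hypotheses (fK : cancel f g) (gK : cancel g f).

Lemma divides_iso a b : divides a b <-> divides (f a) (f b).
Proof.
split=> [[c ->]|[c e]]; first by exists (f c); rewrite rmorphM.
by exists (g c); rewrite -[LHS]fK e rmorphM fK.
Qed.

Lemma unit_iso a : (f a \is a GRing.unit) = (a \is a GRing.unit).
Proof.
apply/idP/idP; last exact: rmorph_unit.
by move/(rmorph_unit g); rewrite fK.
Qed.

Lemma prime_elt_iso p : prime_elt p -> prime_elt (f p).
Proof.
case=> p0 pu pP; split.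
- by apply: contraNneq p0 => e; rewrite -[p]fK e rmorph0.
- by rewrite unit_iso.
move=> a b; rewrite -[a]gK -[b]gK -rmorphM.
by move/divides_iso/pP => [|] /divides_iso; [left|right].
Qed.

Lemma irreducible_elt_iso a : irreducible_elt a -> irreducible_elt (f a).
Proof.
case=> a0 au aP; split.
- by apply: contraNneq a0 => e; rewrite -[a]fK e rmorph0.
- by rewrite unit_iso.
move=> b c e; have : a = g b * g c by rewrite -rmorphM -e fK.
by move/aP; rewrite -!unit_iso !gK.
Qed.

Lemma factorial_ring_iso : factorial_ring A -> factorial_ring B.
Proof.
move=> fA b b0; have [|k] := fA (g b).
  by apply: contraNneq b0 => e; rewrite -[b]gK e rmorph0.
move=> H; exists k; rewrite -[b]gK; elim: H => {k b b0} [u uu|k p a pp _ IH].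
  by constructor; apply: rmorph_unit.
by rewrite rmorphM; constructor=> //; apply: prime_elt_iso.
Qed.

End DivisibilityMorphism.

(** The primes are divided out one at a time: a prime that divides a product
    of primes divides one of them. *)
Lemma prod_divides (A : idomainType) (T : eqType) (s : seq T) (f : T -> A) E :
  uniq s ->
  {in s, forall t, prime_elt (f t)} ->
  {in s, forall t, divides (f t) E} ->
  {in s &, forall t t', t != t' -> ~ divides (f t) (f t')} ->
  divides (\prod_(t <- s) f t) E.
Proof.
elim: s => [|t s IH] /=; first by move=> *; exists E; rewrite big_nil mulr1.
move=> /andP[ts us] pr dv nd; rewrite big_cons.
have sub t' : t' \in s -> t' \in t :: s by rewrite inE orbC => ->.
have [|||q qE] := IH us.
- by move=> t' /sub; apply: pr.
- by move=> t' /sub; apply: dv.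
- by move=> t' t'' /sub ? /sub; apply: nd.
have t0 : t \in t :: s by rewrite inE eqxx.
have [_ tu tP] := pr t t0.
have := dv t t0; rewrite qE => /tP[[x ->]|].
  by exists x; rewrite mulrA.
rewrite big_seq => H; exfalso; move: H.
elim/big_rec: _ => [[x e]|t' y t's IHy /tP[|]].
- by move/unitrPr: tu; case; exists x; rewrite mulrC.
- apply: nd => //; first exact: sub.
  by apply: contraNneq ts => ->.
- exact: IHy.
Qed.

Section PolyFactorial.
Variable A : idomainType.
Implicit Types (a b c p : A) (f g h q r : {poly A}).

Lemma divides_polyC p f :
  divides p%:P f <-> forall i, divides p f`_i.
Proof.
split=> [[g ->] i|H]; first by exists g`_i; rewrite coefMC.
have [c cE] := choice H.
exists (\poly_(i < size f) c i); apply/polyP => i.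
rewrite coefMC coef_poly; case: ltnP => [_|/(nth_default 0) ->] //.
by rewrite mul0r.
Qed.

(** Gauss's lemma. The prime divides the product of the leading coefficients,
    hence one of them; the corresponding leading term can be removed, which
    lowers a degree. *)
Lemma prime_elt_polyC p : prime_elt p -> prime_elt p%:P.
Proof.
move=> [p0 pu pP]; split; first by rewrite polyC_eq0.
  by rewrite poly_unitE size_polyC p0 coefC.
move=> f g; have [n] := ubnP (size f + size g)%N.
elim: n f g => // n IH f g le_n H.
have [->|f0] := eqVneq f 0; first by left; apply: divides0.
have [->|g0] := eqVneq g 0; first by right; apply: divides0.
have step f1 g1 : f1 != 0 -> (size f1 + size g1 < n.+1)%N ->
    divides p%:P (f1 * g1) -> divides p (lead_coef f1) ->
    divides p%:P f1 \/ divides p%:P g1.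
  move=> f10 le_n1 H1 pl; pose m := (lead_coef f1)%:P * 'X^((size f1).-1).
  have pm : divides p%:P m by apply: divides_mulr; case: pl => x ->;
    exists x%:P; rewrite polyCM.
  have [] := IH (f1 - m) g1.
  - rewrite (leq_trans _ (_ : (size f1 + size g1 <= n)%N)) // ltn_add2r.
    have sf : (0 < size f1)%N by rewrite lt0n size_poly_eq0.
    rewrite -[X in (_ < X)%N](prednK sf) ltnS; apply/leq_sizeP => j le_j.
    rewrite coefB coefCM coefXn; case: eqVneq le_j => [->|nj] le_j.
      by rewrite mulr1 lead_coefE subrr.
    by rewrite mulr0 subr0 nth_default // -(prednK sf) ltn_neqAle eq_sym nj.
  - by rewrite mulrBl; apply: dividesB => //; apply: divides_mulr.
  - by move=> H2; left; rewrite -[f1](subrK m); apply: dividesD.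
  - by right.
have /pP[pl|pl] : divides p (lead_coef f * lead_coef g).
  by rewrite -lead_coefM lead_coefE; move/divides_polyC: H.
- exact: step.
- by rewrite or_comm; apply: step => //; rewrite 1?addnC 1?mulrC.
Qed.

Hypothesis fA : factorial_ring A.

(** By Gauss's lemma the prime factors of the constant can be distributed
    between the two factors. *)
Lemma polyC_split c f q r : c != 0 -> c%:P * f = q * r ->
  exists c1 c2 q1 r1, [/\ c = c1 * c2, q = c1%:P * q1, r = c2%:P * r1 &
                          f = q1 * r1].
Proof.
move=> /fA [k H]; elim: H f q r => {k c} [u uu|k p c pp _ IH] f q r e.
  exists 1, u, q, (u^-1%:P * r); rewrite !mul1r mulrA -polyCM divrr // mul1r.
  by split=> //; rewrite mulrCA -e mulrA -polyCM mulVr // mul1r.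
have [p0 _ _] := pp.
have p0' : p%:P != 0 by rewrite polyC_eq0.
have [_ _ /(_ q r)[|[x qE]|[x rE]]] := prime_elt_polyC pp.
- by rewrite -e polyCM -mulrA; apply/divides_mulr/divides_refl.
- have [|c1 [c2 [q1 [r1 [-> xE -> ->]]]]] := IH f x r.
    by apply: (mulfI p0'); rewrite mulrA -polyCM e qE mulrCA mulrA.
  exists (p * c1), c2, q1, r1; rewrite -mulrA; split=> //.
  by rewrite qE xE polyCM mulrC mulrA.
- have [|c1 [c2 [q1 [r1 [-> -> xE ->]]]]] := IH f q x.
    by apply: (mulfI p0'); rewrite mulrA -polyCM e rE mulrA mulrC.
  exists c1, (p * c2), q1, r1; rewrite mulrCA; split=> //.
  by rewrite rE xE polyCM mulrC mulrA.
Qed.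

Lemma unit_size f : f \is a GRing.unit -> (size f <= 1)%N.
Proof. by rewrite poly_unitE => /andP[/eqP ->]. Qed.

(** An irreducible polynomial of positive degree is primitive, so that a
    constant multiplier contributes nothing to divisibility by it. *)
Lemma irreducible_cancel_const f g c : irreducible_elt f -> (1 < size f)%N ->
  c != 0 -> divides f (c%:P * g) -> divides f g.
Proof.
move=> [f0 fu fI] sf c0 [s e].
have [a [b [s1 [f1 [_ _ fE ->]]]]] := polyC_split c0 e.
have [bu|f1u] := fI _ _ fE.
  by rewrite fE; apply: divides_unitl => //; apply/divides_mull/divides_refl.
move: sf; rewrite fE ltnNge => /negP[].
rewrite (leq_trans (size_polyMleq _ _)) // -subn1 leq_subLR.
by rewrite leq_add ?(unit_size f1u) // size_polyC leq_b1.
Qed.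

(** Two coprime polynomials in one variable have a nonzero constant in the
    ideal that they generate: take a nonzero element r of least degree in this
    ideal. Pseudo-division shows that r divides constant multiples of f and of
    g; if r were not constant, it would be a constant multiple of the
    irreducible f, and f would divide g. Applied with polynomials as
    constants, this eliminates a variable between f and g. *)
Lemma elimination f g : irreducible_elt f -> (1 < size f)%N ->
  ~ divides f g -> exists c u v, c != 0 /\ c%:P = u * f + v * g.
Proof.
move=> fI sf nfg; have [f0 fu fP] := fI.
pose I n := `[< exists r u v, [/\ r != 0, r = u * f + v * g & size r = n] >].
have exI : exists n, I n.
  by exists (size f); apply/asboolP; exists f, 1, 0; rewrite mul1r mul0r addr0.
have [n /asboolP[r [u [v [r0 rE sr]]]] nmin] := ex_minnP exI.
have div_r h : (exists u' v', h = u' * f + v' * g) ->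
    exists2 c, c != 0 & divides r (c%:P * h).
  move=> [u' [v' hE]].
  have [k [q [ltr [eE lte]]]] : exists k q rm,
      (lead_coef r ^+ k)%:P * h = q * r + rm /\ (size rm < size r)%N.
    exists (scalp h r), (h %/ r), (h %% r); split; last by rewrite ltn_modp.
    by rewrite mul_polyC Pdiv.Idomain.divp_eq.
  exists (lead_coef r ^+ k); first by rewrite expf_neq0 ?lead_coef_eq0.
  have [e0|e0] := eqVneq ltr 0.
    by exists q; rewrite eE e0 addr0.
  suff : I (size ltr) by move/nmin; rewrite -sr leqNgt lte.
  apply/asboolP; pose L := (lead_coef r ^+ k)%:P.
  exists ltr, (L * u' - q * u), (L * v' - q * v); split=> //.
  rewrite !mulrBl addrACA -opprD -!mulrA -!mulrDr -hE -rE.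
  by rewrite /L eE addrC addKr.
have [c c0 [q e]] : exists2 c, c != 0 & divides r (c%:P * f).
  by apply: div_r; exists 1, 0; rewrite mul1r mul0r addr0.
have [c' c'0 rg] : exists2 c, c != 0 & divides r (c%:P * g).
  by apply: div_r; exists 0, 1; rewrite mul0r mul1r add0r.
have [c1 [c2 [q1 [r1 [cE qE r1E fE]]]]] := polyC_split c0 e.
have [q1u|r1u] := fP _ _ fE.
  case: nfg; apply: (irreducible_cancel_const fI sf c'0).
  apply: divides_trans rg; rewrite r1E fE.
  by apply: divides_unitl => //; apply/divides_mull/divides_refl.
have /size1_polyC rC : (size r <= 1)%N.
  rewrite r1E (leq_trans (size_polyMleq _ _)) // -subn1 leq_subLR.
  by rewrite leq_add ?(unit_size r1u) // size_polyC leq_b1.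
exists r`_0, u, v; rewrite -rC -rE; split=> //.
by move: r0; rewrite {1}rC polyC_eq0.
Qed.

(** When f does not divide g, multiply the relation given by elimination
    by h. *)
Lemma irreducible_prime_poly f : irreducible_elt f -> prime_elt f.
Proof.
move=> fI; have [f0 fu fP] := fI.
have [sf|/size1_polyC fC] := ltnP 1 (size f); last first.
  move: f0 fu fP {fI}; rewrite fC; move: (f`_0) => a.
  move=> a0 au aP; apply: prime_elt_polyC; apply: irreducible_prime => //.
  move: a0; rewrite polyC_eq0 => a0; split=> //.
    by move: au; rewrite poly_unitE size_polyC a0 coefC.
  move=> b c e; case: (aP b%:P c%:P); first by rewrite e polyCM.
    by rewrite poly_unitE coefC => /andP[]; left.
  by rewrite poly_unitE coefC => /andP[]; right.
split=> // g h [s e].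
have [fg|nfg] := pselect (divides f g); first by left.
right; have [c [u [v [c0 cE]]]] := elimination fI sf nfg.
apply: (irreducible_cancel_const fI sf c0).
rewrite cE mulrDl -[v * g * h]mulrA e; apply: dividesD.
  by apply/divides_mulr/divides_mull/divides_refl.
by apply/divides_mull/divides_mull/divides_refl.
Qed.

(** The degree plus the number of prime factors of the leading coefficient
    is additive on products and positive on nonunits, so that factoring
    terminates. *)
Lemma factorial_ring_poly : factorial_ring {poly A}.
Proof.
move=> f f0; have [|k] := fA (_ : lead_coef f != 0).
  by rewrite lead_coef_eq0.
have [n] := ubnP (k + (size f).-1)%N.
elim: n k f f0 => // n IH k f f0 le_n Hk.
have [fu|fu] := boolP (f \is a GRing.unit).
  by exists 0%N; constructor.
have [fI|nfI] := pselect (irreducible_elt f).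
  exists 1%N; rewrite -[f]mulr1; constructor; last first.
    by constructor; apply: unitr1.
  exact: irreducible_prime_poly.
have [g [h [fE gu hu]]] := not_irreducible f0 fu nfI.
move: (f0); rewrite fE mulf_eq0 negb_or => /andP[g0 h0].
have [|i [j [ij Hi Hj]]] :=
  prime_product_split Hk (b := lead_coef g) (c := lead_coef h).
  by rewrite fE lead_coefM.
have pos l q : prime_product l (lead_coef q) -> q != 0 ->
    q \isn't a GRing.unit -> (0 < l + (size q).-1)%N.
  move=> Hl q0 qu; rewrite lt0n; apply: contra qu => /eqP e.
  have sq : size q = 1%N.
    move: e (size_poly_eq0 q).
    by case: (size q) => [|[|?]] //; rewrite ?addnS // (negPf q0).
  have l0 : l = 0%N by move: e; rewrite sq addn0.
  by move: Hl; rewrite poly_unitE sq lead_coefE sq l0 => H; inversion H.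
have : (k + (size f).-1 = (i + (size g).-1) + (j + (size h).-1))%N.
  rewrite -ij fE size_mul // addnACA; congr (_ + _)%N.
  move: g0 h0; rewrite -!size_poly_eq0.
  by case: (size g) => // ?; case: (size h) => //= ?; rewrite addnS.
move: (pos _ _ Hi g0 gu) (pos _ _ Hj h0 hu) => pg ph eD.
have [|ig Hg] := IH _ _ g0 _ Hi.
  by move: le_n; rewrite ltnS eD; apply: leq_trans; rewrite -addn1 leq_add2l.
have [|ih Hh] := IH _ _ h0 _ Hj.
  by move: le_n; rewrite ltnS eD; apply: leq_trans; rewrite -add1n leq_add2r.
by exists (ig + ih)%N; apply: prime_product_mul.
Qed.

End PolyFactorial.

(** * Polynomials in several variables *)

Section MpolyAsPoly.
Variables (A : comNzRingType) (n : nat).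

(** The ring of polynomials in n + 1 variables is identified with polynomials
    in the last variable over polynomials in the first n ones; this is the
    inverse of [muni]. *)
Definition muni_inv : {poly {mpoly A[n]}} -> {mpoly A[n.+1]} :=
  fun p => (map_poly (@mwiden n A) p).['X_ord_max].

Lemma muni_inv_is_zmod_morphism : zmod_morphism muni_inv.
Proof. by move=> p q; rewrite /muni_inv rmorphB hornerD hornerN. Qed.

Lemma muni_inv_is_monoid_morphism : monoid_morphism muni_inv.
Proof.
split; first by rewrite /muni_inv rmorph1 hornerC.
by move=> p q; rewrite /muni_inv rmorphM hornerM.
Qed.

HB.instance Definition _ := GRing.isZmodMorphism.Build
  {poly {mpoly A[n]}} {mpoly A[n.+1]} muni_inv muni_inv_is_zmod_morphism.
HB.instance Definition _ := GRing.isMonoidMorphism.Build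
  {poly {mpoly A[n]}} {mpoly A[n.+1]} muni_inv muni_inv_is_monoid_morphism.

Lemma muni_invD : {morph muni_inv : p q / p + q}.
Proof. exact: rmorphD. Qed.

Lemma muni_invM : {morph muni_inv : p q / p * q}.
Proof. exact: rmorphM. Qed.

Lemma muni_invC p : muni_inv p%:P = mwiden p.
Proof. by rewrite /muni_inv map_polyC hornerC. Qed.

Lemma muni_invX : muni_inv 'X = 'X_ord_max.
Proof. by rewrite /muni_inv map_polyX hornerX. Qed.

Lemma muniX (i : 'I_n) :
  muni ('X_(widen_ord (leqnSn n) i) : {mpoly A[n.+1]}) = ('X_i)%:P.
Proof.
rewrite muniE msuppX big_seq1 mcoeffX eqxx scale1r mnm1E -val_eqE /=.
rewrite ltn_eqF // expr0 -mul_polyC mulr1; congr ('X_[_])%:P.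
by apply/mnmP => j; rewrite mnmE !mnm1E -!val_eqE.
Qed.

Lemma muniX_max : muni ('X_ord_max : {mpoly A[n.+1]}) = 'X.
Proof.
rewrite muniE msuppX big_seq1 mcoeffX eqxx scale1r mnm1E eqxx expr1.
rewrite (_ : [multinom _ | _ < n] = 0%MM) ?mpolyX0 ?scale1r //.
apply/mnmP => j; rewrite mnmE mnm1E mnm0E -val_eqE /=.
by rewrite gtn_eqF.
Qed.

Lemma muni_mwiden (p : {mpoly A[n]}) : muni (mwiden p) = p%:P.
Proof.
elim/mpolyind: p => [|c m p _ _ IH]; first by rewrite mwiden0 muni0.
rewrite mwidenD muniD IH polyCD; congr (_ + _).
rewrite mwidenZ muniZ -mul_polyC -mul_mpolyC polyCM; congr (_ * _).
rewrite mpolyXE_id rmorph_prod /= rmorph_prod rmorph_prod /=.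
apply: eq_bigr => i _; rewrite !rmorphXn /= mwidenX mnmwiden1; congr (_ ^+ _).
exact: muniX.
Qed.

Lemma muni_invK : cancel muni_inv (@muni n A).
Proof.
elim/poly_ind => [|p c IH]; first by rewrite !rmorph0.
rewrite muni_invD muni_invM muni_invX muni_invC.
by rewrite muniD muniM IH muniX_max muni_mwiden.
Qed.

Lemma muniK : cancel (@muni n A) muni_inv.
Proof.
elim/mpolyind => [|c m p _ _ IH]; first by rewrite !rmorph0.
rewrite muniD muni_invD [X in _ + X]IH; congr (_ + _).
rewrite muniZ -mul_polyC.
rewrite muni_invM muni_invC mwidenC mul_mpolyC.
congr (_ *: _).
rewrite mpolyXE_id rmorph_prod (big_morph _ muni_invM (rmorph1 muni_inv)).
apply: eq_bigr => i _; rewrite rmorphXn (rmorphXn muni_inv); congr (_ ^+ _).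
have [j ->|->] := unliftP ord_max i; last first.
  by rewrite /= muniX_max muni_invX.
rewrite (_ : lift _ j = widen_ord (leqnSn n) j); last first.
  by apply: val_inj; rewrite /= /bump leqNgt ltn_ord.
by rewrite /= muniX muni_invC mwidenX mnmwiden1.
Qed.

End MpolyAsPoly.

(** Induction on the number of variables, with Gauss's lemma at each step. *)
Lemma factorial_ring_mpoly (K : fieldType) (n : nat) :
  factorial_ring {mpoly K[n]}.
Proof.
elim: n => [|n IH]; last first.
  pose f : {rmorphism {poly {mpoly K[n]}} -> {mpoly K[n.+1]}} := @muni_inv K n.
  pose g : {rmorphism {mpoly K[n.+1]} -> {poly {mpoly K[n]}}} := @muni n K.
  refine (@factorial_ring_iso {poly {mpoly K[n]}} {mpoly K[n.+1]} f g _ _ _).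
  - exact: muni_invK.
  - exact: muniK.
  - exact: factorial_ring_poly.
move=> p p0; exists 0%N; constructor.
move: p0; rewrite (nvar0_mpolyC p) mpolyC_eq0 => c0.
by apply: rmorph_unit; rewrite unitfE.
Qed.

Lemma prime_elt_mpolyC (A : idomainType) (n : nat) (p : A) :
  prime_elt p -> prime_elt (p%:MP : {mpoly A[n]}).
Proof.
move=> pp; elim: n => [|n IH].
  pose f : {rmorphism A -> {mpoly A[0]}} := @mpolyC 0 A.
  pose g : {rmorphism {mpoly A[0]} -> A} := @mcoeff 0 A 0%MM.
  refine (@prime_elt_iso A {mpoly A[0]} f g _ _ p pp).
    by move=> c; rewrite /= mcoeffC eqxx mulr1.
  exact: mpolyKC.
pose f : {rmorphism {poly {mpoly A[n]}} -> {mpoly A[n.+1]}} := @muni_inv A n.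
pose g : {rmorphism {mpoly A[n.+1]} -> {poly {mpoly A[n]}}} := @muni n A.
rewrite -[p%:MP](@muniK A n) muniC.
refine (@prime_elt_iso {poly {mpoly A[n]}} {mpoly A[n.+1]} f g _ _ _ _).
- exact: muni_invK.
- exact: muniK.
- exact: prime_elt_polyC.
Qed.

(** * Homogeneous polynomials *)

Section Homogeneous.
Variables (A : idomainType) (n : nat).
Implicit Types (p q g : {mpoly A[n]}).

Lemma mcoeff_pihomog d p m :
  (pihomog mdeg d p)@_m = if mdeg m == d then p@_m else 0.
Proof.
rewrite pihomogE raddf_sum /=.
rewrite (eq_bigr (fun m' => p@_m' * (m' == m)%:R)); last first.
  by move=> m' _; rewrite mcoeffZ mcoeffX.
have [mp|/memN_msupp_eq0 e] := boolP (m \in msupp p); last first.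
  rewrite e if_same big1 // => m' _.
  by case: eqVneq => [->|]; rewrite ?mulr0 // e mul0r.
case: ifP => md.
  rewrite -big_filter (bigD1_seq m) ?filter_uniq ?msupp_uniq ?mem_filter ?md //=.
  by rewrite eqxx mulr1 big1 ?addr0 // => m' /negPf ->; rewrite mulr0.
rewrite big1 // => m' md'; case: eqVneq => [e|]; rewrite ?mulr0 //.
by rewrite -e md' in md.
Qed.

Lemma pihomogM d k p q : (msize p <= k)%N -> (msize q <= k)%N ->
  pihomog mdeg d (p * q) = \sum_(i < k) \sum_(j < k)
    (if (i + j == d)%N then pihomog mdeg i p * pihomog mdeg j q else 0).
Proof.
move=> pk qk; rewrite {1}(pihomog_partitionE pk) {1}(pihomog_partitionE qk).
rewrite mulr_suml raddf_sum; apply: eq_bigr => i _ /=.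
rewrite mulr_sumr raddf_sum; apply: eq_bigr => j _ /=.
have H := dhomogM (pihomogP mdeg i p) (pihomogP mdeg j q).
case: eqVneq => [<-|ne]; first by rewrite pihomog_dE.
exact: (pihomog_ne0 ne).
Qed.

Lemma pihomog_mul_homog d m p g : g \is m.-homog ->
  exists w, pihomog mdeg d (p * g) = w * g.
Proof.
move=> hg; exists (\sum_(i < msize p)
  if (i + m == d)%N then pihomog mdeg i p else 0).
rewrite {1}(pihomog_partitionE (leqnn (msize p))) !mulr_suml raddf_sum.
apply: eq_bigr => i _ /=; have H := dhomogM (pihomogP mdeg i p) hg.
case: eqVneq => [<-|ne]; first by rewrite pihomog_dE.
by rewrite mul0r; apply: (pihomog_ne0 ne).
Qed.

Lemma min_homog_component p : p != 0 ->
  exists2 a, pihomog mdeg a p != 0 &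
    forall i, pihomog mdeg i p != 0 -> (a <= i)%N.
Proof.
move=> p0; have exP : exists a, pihomog mdeg a p != 0.
  exists (mdeg (mlead p)); apply: contraNneq p0 => e.
  by rewrite -mleadc_eq0 -(mcoeff0 A (mlead p)) -e mcoeff_pihomog eqxx.
by have [a Ha Hmin] := ex_minnP exP; exists a.
Qed.

(** The product of the components of least degree of the factors is nonzero,
    and so is that of the components of greatest degree; both lie in the degree
    of the product, hence least and greatest degrees agree in each factor. *)
Lemma homog_factor d p q : p * q != 0 -> p * q \is d.-homog ->
  exists i j, [/\ p \is i.-homog, q \is j.-homog & (i + j)%N = d].
Proof.
move=> pq0 hpq; move: (pq0); rewrite mulf_eq0 negb_or => /andP[p0 q0].
have [a pa amin] := min_homog_component p0.
have [b qb bmin] := min_homog_component q0.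
have hom (r : {mpoly A[n]}) c : r != 0 ->
    (forall i, pihomog mdeg i r != 0 -> (c <= i)%N) ->
    (mdeg (mlead r) <= c)%N -> r \is c.-homog.
  move=> r0 cmin le_c; apply/dhomogP => m mr /=; apply/eqP.
  rewrite eqn_leq (leq_trans (lemc_mdeg (msupp_le_mlead mr)) le_c) /=.
  apply: cmin; apply: contraTneq mr => /(congr1 (mcoeff m)).
  by rewrite mcoeff_msupp mcoeff_pihomog eqxx mcoeff0 => ->; rewrite eqxx.
have le_lead (r : {mpoly A[n]}) c : r != 0 ->
    (forall i, pihomog mdeg i r != 0 -> (c <= i)%N) ->
    (c <= mdeg (mlead r))%N.
  move=> r0; apply; apply: contraNneq r0 => e.
  by rewrite -mleadc_eq0 -(mcoeff0 A (mlead r)) -e mcoeff_pihomog eqxx.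
have abd : (a + b)%N = d.
  apply/eqP; apply: contraT => ne.
  have := pihomog_ne0 _ hpq => /(_ (a + b)%N); rewrite eq_sym ne => /(_ isT).
  rewrite (pihomogM _ (leq_maxl (msize p) (msize q)) (leq_maxr _ _)).
  set k := maxn _ _.
  have lt_msize (r : {mpoly A[n]}) c :
      pihomog mdeg c r != 0 -> (c < msize r)%N.
    move=> H; rewrite ltnNge; apply: contra H => /= le.
    apply/eqP/mpolyP => m; rewrite mcoeff0 mcoeff_pihomog; case: eqVneq => // e.
    by apply/memN_msupp_eq0/msize_mdeg_ge; rewrite e.
  have ak : (a < k)%N by rewrite (leq_trans (lt_msize _ _ pa)) ?leq_maxl.
  have bk : (b < k)%N by rewrite (leq_trans (lt_msize _ _ qb)) ?leq_maxr.
  rewrite (bigD1 (Ordinal ak)) //= (bigD1 (Ordinal bk)) //= eqxx.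
  rewrite (big1 _ (fun j => j != Ordinal bk)) ?addr0; last first.
    by move=> j; rewrite -val_eqE eqn_add2l => /negPf ->.
  rewrite big1 ?addr0 => [/eqP|i ni].
    by rewrite mulf_eq0 (negPf pa) (negPf qb).
  apply: big1 => j _; case: eqVneq => // e.
  have [->|/amin le_ai] := eqVneq (pihomog mdeg i p) 0; first by rewrite mul0r.
  have [->|/bmin le_bj] := eqVneq (pihomog mdeg j q) 0; first by rewrite mulr0.
  suff : i == a :> nat by rewrite -val_eqE /= in ni; rewrite (negPf ni).
  by rewrite eqn_leq le_ai andbT -(leq_add2r b) -e leq_add2l.
have leadD : (mdeg (mlead p) + mdeg (mlead q))%N = d.
  by rewrite -mdegD -mleadM //; apply: (dhomog_mf hpq); apply: mlead_supp.
exists a, b; split=> //; apply: hom => //.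
  rewrite -(leq_add2r (mdeg (mlead q))) leadD -abd leq_add2l.
  exact: le_lead.
rewrite -(leq_add2l (mdeg (mlead p))) leadD -abd leq_add2r.
exact: le_lead.
Qed.

Lemma mpoly_unitP p : reflect (exists2 c, c \is a GRing.unit & p = c%:MP)
  (p \is a GRing.unit).
Proof.
apply: (iffP idP) => [|[c cu ->]]; last exact: rmorph_unit.
by case/andP=> /eqP e ?; exists p@_0.
Qed.

Lemma homog0C p : p \is 0.-homog -> p = (p@_0)%:MP.
Proof.
move=> hp; apply: msize1_polyC; rewrite msizeE; apply/bigmax_leqP_seq => m mp _.
by rewrite ltnS leqn0 (dhomog_mf hp).
Qed.

End Homogeneous.

(** * Derivations and their constants *)

Record derivation (R : nzRingType) := Derivation {
  deriv_fun :> R -> R;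
  derivationD : {morph deriv_fun : x y / x + y};
  derivationM : forall x y,
    deriv_fun (x * y) = deriv_fun x * y + x * deriv_fun y }.

Section DerivationTheory.
Variables (R : nzRingType) (D : derivation R).

Lemma derivation0 : D 0 = 0.
Proof. by apply: (addrI (D 0)); rewrite -derivationD !addr0. Qed.

Lemma derivation1 : D 1 = 0.
Proof.
by apply: (addrI (D 1)); rewrite -{3}[1]mulr1 derivationM mulr1 mul1r addr0.
Qed.

Lemma derivationN x : D (- x) = - D x.
Proof. by apply: (addrI (D x)); rewrite -derivationD !subrr derivation0. Qed.

Lemma derivationB x y : D (x - y) = D x - D y.
Proof. by rewrite derivationD derivationN. Qed.

Lemma derivation_sum I (r : seq I) (P : pred I) (f : I -> R) :
  D (\sum_(i <- r | P i) f i) = \sum_(i <- r | P i) D (f i).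
Proof. exact: (big_morph _ (derivationD D) derivation0). Qed.

End DerivationTheory.

Section Constants.
Variables (F : fieldType) (D : derivation F).

Definition constant_pred : {pred F} := [pred x | D x == 0].

Lemma constant_divring_closed : divring_closed constant_pred.
Proof.
split; rewrite ?inE ?derivation1 // => x y; rewrite !inE => /eqP Dx /eqP Dy.
  by rewrite derivationB Dx Dy subr0.
have [->|y0] := eqVneq y 0; first by rewrite invr0 mulr0 derivation0.
rewrite -(inj_eq (mulIf y0)) mul0r.
have : D (x / y * y) = D (x / y) * y + x / y * D y by rewrite derivationM.
by rewrite divfK // Dy mulr0 addr0 Dx => <-.
Qed.

HB.instance Definition _ :=
  GRing.isDivringClosed.Build F constant_pred constant_divring_closed.

Record constants := Constant {
  constant_val : F;
  _ : constant_val \in constant_pred }.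

HB.instance Definition _ := [isSub for constant_val].
HB.instance Definition _ := [Choice of constants by <:].
HB.instance Definition _ := [SubChoice_isSubComUnitRing of constants by <:].
HB.instance Definition _ :=
  [SubComUnitRing_isSubIntegralDomain of constants by <:].
HB.instance Definition _ := [SubIntegralDomain_isSubField of constants by <:].

(** Sealed, so that simplification never replaces the morphism by the bare
    projection. *)
Fact constant_incl_spec : {f : {rmorphism constants -> F} | f =1 \val}.
Proof. by exists \val. Qed.

Definition constant_incl : {rmorphism constants -> F} := sval constant_incl_spec.

Lemma derivation_constant x : D (constant_incl x) = 0.
Proof. by rewrite (svalP constant_incl_spec); apply/eqP; case: x. Qed.

Lemma constant_incl_onto y : D y = 0 -> exists x, constant_incl x = y.
Proof.
by move=> /eqP Dy; exists (Constant Dy); rewrite (svalP constant_incl_spec).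
Qed.

End Constants.

Section FractionDerivation.
Variables (R : idomainType) (D : derivation R).
Local Notation "x %:F" := (@FracField.tofrac R x).

Lemma fraction_repr (x : {fraction R}) :
  exists a b, b != 0 /\ x * b%:F = a%:F.
Proof.
elim/quotW: x => r.
exists (\n_r), (\d_r); split; first exact: denom_ratioP.
rewrite !piE; apply/eqmodP => /=.
rewrite FracField.equivfE /FracField.mulf !numden_Ratio //.
all: rewrite ?oner_neq0 ?mulr1 ?denom_ratioP //.
by rewrite mulrC.
Qed.

(** The quotient rule, applied to a representative chosen for each fraction. *)
Lemma fraction_deriv_exists : exists D' : derivation {fraction R},
  forall a : R, D' a%:F = (D a)%:F.
Proof.
have /choice[n /choice[d nd]] := fraction_repr.
pose D' x := ((D (n x))%:F - x * (D (d x))%:F) / (d x)%:F.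
(* The value does not depend on the representative. *)
have key x (a b : R) : b != 0 -> x * b%:F = a%:F ->
    D' x * b%:F = (D a)%:F - x * (D b)%:F.
  move=> b0 e; have [d0 xd] := nd x.
  have dF : (d x)%:F != 0 :> {fraction R} by rewrite tofrac_eq0.
  have bF : b%:F != 0 :> {fraction R} by rewrite tofrac_eq0.
  have nb : n x * b = a * d x.
    by apply/eqP; rewrite -tofrac_eq !tofracM -xd -e; apply/eqP; ring.
  have DE : (D (n x))%:F * b%:F + x * (d x)%:F * (D b)%:F
            = (D a)%:F * (d x)%:F + x * b%:F * (D (d x))%:F.
    by rewrite xd e -!tofracM -!tofracD -!derivationM nb.
  apply: (mulIf dF); rewrite /D' mulrAC divfK // mulrBl mulrBl.
  apply/eqP; rewrite subr_eq addrAC eq_sym subr_eq; apply/eqP.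
  rewrite [RHS]addrC.
  move: DE; set u := _%:F * b%:F; set w := _%:F * (d x)%:F => DE.
  have -> : x * (D b)%:F * (d x)%:F = x * (d x)%:F * (D b)%:F by ring.
  have -> : x * (D (d x))%:F * b%:F = x * b%:F * (D (d x))%:F by ring.
  by rewrite -DE addrC.
have DD : {morph D' : x y / x + y}.
  move=> x y; have [[x0 xd] [y0 yd]] := (nd x, nd y).
  have bF : (d x * d y)%:F != 0 :> {fraction R} by rewrite tofrac_eq0 mulf_neq0.
  apply: (mulIf bF).
  rewrite (key _ (n x * d y + n y * d x)) ?mulf_neq0 //; last first.
    by rewrite tofracD !tofracM -xd -yd; ring.
  have -> : (D' x + D' y) * (d x * d y)%:F =
      D' x * (d x)%:F * (d y)%:F + D' y * (d y)%:F * (d x)%:F.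
    by rewrite tofracM; ring.
  rewrite (key x (n x) (d x)) // (key y (n y) (d y)) //.
  rewrite derivationD !derivationM !tofracD !tofracM -xd -yd; ring.
have DM x y : D' (x * y) = D' x * y + x * D' y.
  have [[x0 xd] [y0 yd]] := (nd x, nd y).
  have bF : (d x * d y)%:F != 0 :> {fraction R} by rewrite tofrac_eq0 mulf_neq0.
  apply: (mulIf bF).
  rewrite (key _ (n x * n y)) ?mulf_neq0 //; last first.
    by rewrite !tofracM -xd -yd; ring.
  have -> : (D' x * y + x * D' y) * (d x * d y)%:F =
     D' x * (d x)%:F * (y * (d y)%:F) + x * (d x)%:F * (D' y * (d y)%:F).
    by rewrite tofracM; ring.
  rewrite (key x (n x) (d x)) // (key y (n y) (d y)) //.
  rewrite !derivationM !tofracD !tofracM -xd -yd; ring.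
exists (Derivation DD DM) => a /=.
have := key a%:F a 1 (oner_neq0 R); rewrite tofrac1 !mulr1 => -> //.
by rewrite derivation1 tofrac0 mulr0 subr0.
Qed.

End FractionDerivation.

(** * Polynomial vector fields and Wronskians *)

Section MpolyRingInduction.
Variables (A : nzRingType) (n : nat) (P : {mpoly A[n]} -> Prop).
Hypotheses (PC : forall c, P c%:MP) (PX : forall i, P 'X_i).
Hypotheses (PD : forall p q, P p -> P q -> P (p + q)).
Hypotheses (PM : forall p q, P p -> P q -> P (p * q)).

Lemma mpoly_ring_ind p : P p.
Proof.
have P0 : P 0 by rewrite -(mpolyC0 n A).
have P1 : P 1 by rewrite -(mpolyC1 n A).
elim/mpolyind: p => // c m p _ _ Pp; apply: PD => //.
rewrite -mul_mpolyC; apply: PM => //; rewrite mpolyXE_id.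
elim/big_ind: _ => // i _; elim: (m i) => [|k IH]; first by rewrite expr0.
by rewrite exprS; apply: PM.
Qed.

End MpolyRingInduction.

Section PolynomialVectorField.
Variables (A : comNzRingType) (n : nat) (X : 'I_n -> {mpoly A[n]}).
Implicit Types p q : {mpoly A[n]}.

Definition mvf p : {mpoly A[n]} := \sum_(i < n) X i * p^`M(i).

Lemma mvfD : {morph mvf : p q / p + q}.
Proof.
by move=> p q; rewrite -big_split; apply: eq_bigr => i _; rewrite mderivD mulrDr.
Qed.

Lemma mvfM p q : mvf (p * q) = mvf p * q + p * mvf q.
Proof.
rewrite /mvf mulr_suml mulr_sumr -big_split; apply: eq_bigr => i _ /=.
by rewrite mderivM; ring.
Qed.

Definition mvf_derivation := Derivation mvfD mvfM.

Lemma mvf_sum I (r : seq I) (P : pred I) (f : I -> {mpoly A[n]}) :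
  mvf (\sum_(i <- r | P i) f i) = \sum_(i <- r | P i) mvf (f i).
Proof. exact: (derivation_sum mvf_derivation). Qed.

Lemma mvfC c : mvf c%:MP = 0.
Proof. by apply: big1 => i _; rewrite mderivC mulr0. Qed.

Lemma mvfZ c p : mvf (c *: p) = c *: mvf p.
Proof. by rewrite -mul_mpolyC mvfM mvfC mul0r add0r mul_mpolyC. Qed.

Lemma mvfX i : mvf 'X_i = X i.
Proof.
rewrite /mvf (bigD1 i) //= mderivX mnm1E eqxx scale1r.
rewrite (_ : (U_(i) - U_(i))%MM = 0%MM) ?mpolyX0 ?mulr1; last first.
  by apply/mnmP => j; rewrite mnmBE subnn mnm0E.
rewrite big1 ?addr0 // => j ji; rewrite mderivX mnm1E eq_sym (negPf ji).
by rewrite scale0r mulr0.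
Qed.

End PolynomialVectorField.

Section HomogeneousField.
Variables (A : idomainType) (n : nat).
Implicit Types p : {mpoly A[n]}.

Lemma mderiv_homog e i p : p \is e.-homog -> p^`M(i) \is e.-1.-homog.
Proof.
move=> hp; apply/dhomogP => m; rewrite mcoeff_msupp mcoeff_deriv => nz.
have : (m + U_(i))%MM \in msupp p.
  by rewrite mcoeff_msupp; apply: contraNneq nz => ->; rewrite mul0rn.
by move/(dhomog_mf hp) => /=; rewrite mdegD mdeg1 addn1 => <-.
Qed.

(** The truncated subtraction is harmless: a field with constant coefficients
    kills the constants, and 0 is homogeneous of every degree. *)
Lemma mvf_homog d e (X : 'I_n -> {mpoly A[n]}) p :
  (forall i, X i \is d.-homog) -> p \is e.-homog ->
  mvf X p \is (e + d - 1).-homog.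
Proof.
move=> hX hp; apply: rpred_sum => i _; case: e hp => [|e] hp.
  by rewrite (homog0C hp) mderivC mulr0 dhomog0.
by rewrite addSn subn1 addnC /=; apply: dhomogM => //; apply: (mderiv_homog i hp).
Qed.

End HomogeneousField.

Section Wronskian.
Variables (F : fieldType) (D : derivation F) (N : nat) (v : 'I_N -> F).

(** Let r be the last row of the Wronskian matrix used by a relation between
    its rows. The vectors c killed by the first r rows form a nonzero space,
    because r < N; they are killed by row r too, and differentiating their
    equations shows that this space is stable under D. A nonzero vector c of
    least support in it, normalized to have an entry equal to 1, satisfies
    D c = 0, since D c is in the space and has a smaller support. *)
Lemma wronskian_dependent :
  \det (\matrix_(i < N, j < N) iter i D (v j)) = 0 ->
  exists c : 'I_N -> F, [/\ exists j, c j != 0, forall j, D (c j) = 0 &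
                            \sum_j c j * v j = 0].
Proof.
move=> /eqP/det0P[l l0 lW].
have [r0 lr0] : exists i, l 0 i != 0 by apply/rV0Pn.
have [r lr rmax] := @arg_maxnP _ r0 (fun i => l 0 i != 0) val lr0.
have {lW} rel j : \sum_(i < N) l 0 i * iter i D (v j) = 0.
  move/matrixP: lW => /(_ 0 j); rewrite !mxE => e; rewrite -[RHS]e.
  by apply: eq_bigr => i _; rewrite mxE.
pose Z (c : 'I_N -> F) :=
  forall i : 'I_N, (i <= r)%N -> \sum_j c j * iter i D (v j) = 0.
(* Row r is a combination of the rows above it. *)
have Zr c :
    (forall i : 'I_N, (i < r)%N -> \sum_j c j * iter i D (v j) = 0) -> Z c.
  move=> H i; rewrite leq_eqVlt => /predU1P[/val_inj ->|/H //].
  apply: (mulfI lr); rewrite mulr0 mulr_sumr.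
  have : \sum_j c j * \sum_(i < N) l 0 i * iter i D (v j) = 0.
    by apply: big1 => j _; rewrite rel mulr0.
  under eq_bigr do rewrite mulr_sumr.
  rewrite exchange_big (bigD1 r) //= [X in _ + X]big1 ?addr0 => [e|i' ne].
    by rewrite -[RHS]e; apply: eq_bigr => j _; rewrite mulrCA.
  have [le|gt] := leqP i' r.
    under eq_bigr do rewrite mulrCA.
    by rewrite -mulr_sumr H ?mulr0 // ltn_neqAle le andbT.
  apply: big1 => j _; suff -> : l 0 i' = 0 by rewrite mul0r mulr0.
  by apply: contraTeq gt => /rmax; rewrite -leqNgt.
have ZD c : Z c -> Z (fun j => D (c j)).
  move=> Zc; apply: Zr => i lt_ir.
  have lt_iN : (i.+1 < N)%N by apply: leq_ltn_trans (ltn_ord r).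
  have := Zc i (ltnW lt_ir) => /(congr1 D); rewrite derivation0 derivation_sum.
  under eq_bigr do rewrite derivationM.
  rewrite big_split /=.
  have -> : \sum_j c j * D (iter i D (v j)) = 0 by exact: (Zc (Ordinal lt_iN)).
  by rewrite addr0.
have [c0 [j0 c0j] Zc0] : exists2 c, (exists j, c j != 0) & Z c.
  pose U : 'M[F]_(N, r) := \matrix_(j, i) iter i D (v j).
  have : ~~ row_free U.
    rewrite /row_free neq_ltn (leq_ltn_trans (rank_leq_col _) (ltn_ord r)) //.
  rewrite -kermx_eq0 => /rowV0Pn[c /sub_kermxP cU /rV0Pn[j cj]].
  exists (fun j => c 0 j); first by exists j.
  apply: Zr => i lt_ir.
  move/matrixP: cU => /(_ 0 (Ordinal lt_ir)); rewrite !mxE => e; rewrite -[RHS]e.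
  by apply: eq_bigr => j' _; rewrite mxE.
pose w (c : 'I_N -> F) := #|[pred j | c j != 0]|.
pose Q m := `[< exists c, [/\ Z c, exists j, c j != 0 & w c = m] >].
have exQ : exists m, Q m.
  by exists (w c0); apply/asboolP; exists c0; split=> //; exists j0.
have [m /asboolP[c [Zc [j cj] wc]] mmin] := ex_minnP exQ.
pose c1 i := c i / c j.
have Zc1 : Z c1.
  move=> i /Zc e; rewrite -[RHS](mul0r (c j)^-1) -[in RHS]e mulr_suml.
  by apply: eq_bigr => i' _; rewrite mulrAC.
have c1j : c1 j = 1 by rewrite /c1 divff.
exists c1; split.
- by exists j; rewrite c1j oner_neq0.
- move=> i; apply/eqP; apply: contraT => Dc.
  suff : (w (fun i => D (c1 i)) < w c)%N.
    rewrite ltnNge wc => /negP[]; apply: mmin; apply/asboolP.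
    by exists (fun i => D (c1 i)); split; [apply: ZD|exists i|].
  apply: proper_card; apply/properP; split.
    apply/fintype.subsetP => i'; rewrite !inE; apply: contraNneq => e.
    by rewrite /c1 e mul0r derivation0.
  by exists j; rewrite !inE // c1j derivation1 eqxx.
- have N0 : (0 < N)%N by apply: leq_ltn_trans (ltn_ord r).
  exact: (Zc1 (Ordinal N0)).
Qed.

End Wronskian.

(** * First integrals *)

Section FirstIntegrals.
Variables (K : fieldType) (X : 'I_3 -> {mpoly K[3]}).
Implicit Types P Q : {mpoly K[3]}.

(** A rational first integral given by a representation that need not be
    reduced. *)
Definition rational_invariant e P Q :=
  [/\ P \is e.-homog, Q \is e.-homog, Q != 0,
      forall c : K, P <> c%:MP * Q & vf_apply X P * Q = P * vf_apply X Q].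

Lemma vf_applyE P : vf_apply X P = mvf X P.
Proof. by []. Qed.

Lemma vf_applyM P Q : vf_apply X (P * Q) = vf_apply X P * Q + P * vf_apply X Q.
Proof. exact: (mvfM X). Qed.

(** A representation of least degree is reduced: a common factor of two
    homogeneous polynomials is homogeneous and can be divided out. *)
Lemma rational_invariant_first_integral e P Q : rational_invariant e P Q ->
  exists e', (e' <= e)%N /\ has_first_integral X e'.
Proof.
have [n] := ubnP e; elim: n e P Q => // n IH e P Q le_en [hP hQ Q0 nc XPQ].
have QF : @FracField.tofrac {mpoly K[3]} Q != 0 by rewrite tofrac_eq0.
have [cop|ncop] := pselect (coprime_mpoly P Q).
  exists e; split=> //; exists P, Q; split; first by split.
  split=> [c|].
    move/(congr1 (fun u => u * @FracField.tofrac {mpoly K[3]} Q)).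
    rewrite /mpoly_frac divfK // -rmorphM => /eqP.
    by rewrite tofrac_eq => /eqP; apply: nc.
  by rewrite /vf_apply_frac XPQ subrr /mpoly_frac rmorph0 mul0r.
have [G [[P' PE] [Q' QE] Gu]] : exists G, [/\ exists P', P = G * P',
    exists Q', Q = G * Q' & G \isn't a GRing.unit].
  apply: contrapT => H; apply: ncop => G hP' hQ'; apply: contrapT => Gu.
  by apply: H; exists G; split=> //; apply/negP.
have P0 : P != 0 by apply/eqP => P0; apply: (nc 0); rewrite mpolyC0 mul0r.
have [i [j [hG hQ' ij]]] : exists i j,
    [/\ G \is i.-homog, Q' \is j.-homog & (i + j)%N = e].
  by apply: homog_factor; rewrite -QE.
have [i' [j' [hG' hP' ij']]] : exists i j,
    [/\ G \is i.-homog, P' \is j.-homog & (i + j)%N = e].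
  by apply: homog_factor; rewrite -PE.
have G0 : G != 0 by apply: contraNneq Q0 => G0; rewrite QE G0 mul0r.
have ii' := dhomog_uniq G0 hG hG'.
have jj' : j' = j by apply: (@addnI i); rewrite ij ii' ij'.
have i_gt0 : (0 < i)%N.
  rewrite lt0n; apply: contra Gu => /eqP i0; move: hG; rewrite i0 => /homog0C GE.
  apply/mpoly_unitP; exists G@_0 => //; rewrite unitfE.
  by rewrite -(mpolyC_eq0 3) -GE.
have lt_je : (j < e)%N by rewrite -ij -[X in (X < _)%N]add0n ltn_add2r.
have [|e' [le_e' fi]] := IH j P' Q' (leq_trans lt_je le_en); last first.
  by exists e'; split=> //; apply: leq_trans (ltnW lt_je).
split=> //; first by rewrite -jj'.
- by apply: contraNneq Q0 => Q'0; rewrite QE Q'0 mulr0.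
- by move=> c e1; apply: (nc c); rewrite PE QE e1 mulrCA.
- apply/eqP; rewrite -subr_eq0; apply/eqP; apply: (mulfI (mulf_neq0 G0 G0)).
  rewrite mulr0; move/eqP: XPQ; rewrite PE QE !vf_applyM -subr_eq0 => /eqP <-.
  ring.
Qed.

End FirstIntegrals.

(** * Extending coefficients; relations between coordinates *)

Section MapMpoly.
Variables (n : nat) (A B : comNzRingType) (f : {rmorphism A -> B}).

Lemma mmap_map_mpoly (h : 'I_n -> B) p : mmap f h p = (map_mpoly f p).@[h].
Proof.
elim/mpoly_ring_ind: p => [c|i|p q Hp Hq|p q Hp Hq].
- by rewrite mmapC map_mpolyC mevalC.
- by rewrite mmapX mmap1U map_mpolyX mevalXU.
- by rewrite mmapD rmorphD mevalD Hp Hq.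
- by rewrite !rmorphM /= Hp Hq.
Qed.

Lemma map_mderiv i (p : {mpoly A[n]}) :
  map_mpoly f p^`M(i) = (map_mpoly f p)^`M(i).
Proof.
apply/mpolyP => m.
by rewrite mcoeff_map_mpoly !mcoeff_deriv mcoeff_map_mpoly raddfMn.
Qed.

Lemma map_mvf X (p : {mpoly A[n]}) :
  map_mpoly f (mvf X p) = mvf (fun i => map_mpoly f (X i)) (map_mpoly f p).
Proof.
rewrite /mvf raddf_sum; apply: eq_bigr => i _.
by rewrite /= rmorphM /= map_mderiv.
Qed.

Lemma map_mpoly_inj : injective f -> injective (@map_mpoly n A B f).
Proof.
move=> fI p q /mpolyP e; apply/mpolyP => m; apply: fI.
by have := e m; rewrite !mcoeff_map_mpoly.
Qed.

Lemma map_mpoly_homog d (p : {mpoly A[n]}) :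
  p \is d.-homog -> map_mpoly f p \is d.-homog.
Proof.
move=> hp; apply/dhomogP => m; rewrite mcoeff_msupp mcoeff_map_mpoly => nz.
apply: (dhomog_mf hp); rewrite mcoeff_msupp.
by apply: contraNneq nz => ->; rewrite raddf0.
Qed.

End MapMpoly.

Lemma lift_constants (F : fieldType) (D : derivation F) n (p : {mpoly F[n]}) :
  (forall m, D p@_m = 0) ->
  exists q : {mpoly (constants D)[n]}, map_mpoly (constant_incl D) q = p.
Proof.
move=> H; have /choice[c cE] := fun m => constant_incl_onto (H m).
exists (\sum_(m <- msupp p) c m *: 'X_[m]).
rewrite raddf_sum [RHS]mpolyE; apply: eq_bigr => m _.
by rewrite /= map_mpolyZ map_mpolyX cE.
Qed.

Lemma clear_denominators (S : idomainType) (F : fieldType)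
    (f : {rmorphism S -> F}) n (p : {mpoly F[n]}) :
  (forall c, exists u b, b != 0 /\ c * f b = f u) ->
  exists a q, a != 0 /\ map_mpoly f q = (f a)%:MP * p.
Proof.
move=> frac; elim/mpolyind: p => [|c m p _ _ [a [q [a0 qE]]]].
  by exists 1, 0; rewrite oner_neq0 raddf0 mulr0.
have [u [b [b0 cE]]] := frac c.
exists (b * a), (b%:MP * q + (a * u)%:MP * 'X_[m]).
rewrite mulf_neq0 //; split=> //.
have fC x : map_mpoly f x%:MP_[n] = (f x)%:MP by exact: map_mpolyC.
rewrite rmorphD !rmorphM /= !fC qE map_mpolyX.
rewrite -[c *: _]mul_mpolyC -cE !rmorphM /=; ring.
Qed.

(** Euler's identity. *)
Lemma euler_homog (A : idomainType) n d (p : {mpoly A[n]}) : p \is d.-homog ->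
  \sum_(i < n) 'X_i * p^`M(i) = p *+ d.
Proof.
move=> /dhomogP hp; rewrite [p in RHS]mpolyE -sumrMnl.
transitivity (\sum_(i < n) 'X_i * (\sum_(m <- msupp p) p@_m *: 'X_[m])^`M(i)).
  by rewrite -mpolyE.
under eq_bigr do rewrite raddf_sum mulr_sumr.
rewrite exchange_big /= big_seq [RHS]big_seq; apply: eq_bigr => m mp.
rewrite -(hp m mp) /= mdegE -sumrMnr; apply: eq_bigr => i _.
rewrite mderivZ mderivX -!scalerAr scaler_nat -scalerMnr.
have [->|mi] := eqVneq (m i) 0%N; first by rewrite !mulr0n.
by rewrite -mpolyXD addmC submK // lep1mP.
Qed.

Section AlgebraicOverConstants.
Variables (k F : fieldType) (iota : {rmorphism k -> F}) (D : derivation F).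
Hypothesis D_iota : forall c, D (iota c) = 0.
Hypothesis char0 : forall n, n.+1%:R != 0 :> k.

Lemma derivation_mmap n (x : 'I_n -> F) p :
  D (mmap iota x p) = \sum_(i < n) mmap iota x p^`M(i) * D (x i).
Proof.
elim/mpoly_ring_ind: p => [c|i|p q Hp Hq|p q Hp Hq].
- rewrite mmapC D_iota big1 // => i _.
  by rewrite mderivC mmap0 mul0r.
- rewrite mmapX mmap1U (bigD1 i) //= mderivX mnm1E eqxx scale1r.
  rewrite (_ : (U_(i) - U_(i))%MM = 0%MM) ?mpolyX0 ?rmorph1 ?mul1r; last first.
    by apply/mnmP => j; rewrite mnmBE subnn mnm0E.
  rewrite big1 ?addr0 // => j ji; rewrite mderivX mnm1E eq_sym (negPf ji).
  by rewrite scale0r mmap0 mul0r.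
- rewrite mmapD derivationD Hp Hq -big_split; apply: eq_bigr => i _ /=.
  by rewrite mderivD mmapD mulrDl.
- rewrite rmorphM derivationM Hp Hq mulr_suml mulr_sumr -big_split.
  apply: eq_bigr => i _ /=.
  by rewrite mderivM mmapD !rmorphM /=; ring.
Qed.

(** If two coordinates satisfy a binary form with constant coefficients,
    their quotient is algebraic over the constants, hence constant. Take a form
    of least degree: its gradient at x does not vanish, because the partial
    derivatives are forms of smaller degree; but it is orthogonal to x by
    Euler's identity and to D x by differentiating the relation. *)
Lemma binary_form_zero d (x : 'I_2 -> F) (p : {mpoly k[2]}) :
  p \is d.-homog -> p != 0 -> mmap iota x p = 0 ->
  x ord0 * D (x ord_max) = x ord_max * D (x ord0).
Proof.
elim: d p => [|d IH] p hp p0 px.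
  move: p0 px; rewrite (homog0C hp) mmapC mpolyC_eq0 => c0 /eqP.
  by rewrite fmorph_eq0 (negPf c0).
have hq i : p^`M(i) \is d.-homog by apply: (mderiv_homog i hp).
have [[i [qi0 qix]]|nq] :=
    pselect (exists i, p^`M(i) != 0 /\ mmap iota x p^`M(i) = 0).
  exact: (IH _ (hq i)).
have q0 i : mmap iota x p^`M(i) = 0 -> p^`M(i) = 0.
  move=> e; apply/eqP; apply: contraT => ne.
  by case: nq; exists i.
have := euler_homog hp => /(congr1 (mmap iota x)); rewrite raddfMn /= px mul0rn.
have := derivation_mmap x p; rewrite px derivation0.
rewrite !big_ord_recl !big_ord0 !addr0 !mmapD !rmorphM /= !mmapX !mmap1U.
rewrite (_ : lift ord0 ord0 = ord_max); last by apply: val_inj.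
set a := mmap _ _ _; set b := mmap _ _ _ => e1 e2.
have [a0|a0] := eqVneq a 0.
  have [b0|b0] := eqVneq b 0.
    case/eqP: p0; apply/eqP; have := euler_homog hp.
    rewrite !big_ord_recl !big_ord0 !addr0.
    rewrite (_ : lift ord0 ord0 = ord_max); last by apply: val_inj.
    rewrite (q0 _ a0) (q0 _ b0) !mulr0 addr0 -scaler_nat => /esym/eqP.
    by rewrite mscalerI (negPf (char0 d)) => /eqP ->.
  apply: (mulfI b0); apply/eqP; rewrite -subr_eq0; apply/eqP.
  transitivity (x ord0 * (a * D (x ord0) + b * D (x ord_max)) -
    D (x ord0) * (x ord0 * a + x ord_max * b)); first by ring.
  by rewrite -e1 e2 !mulr0 subr0.
apply: (mulfI a0); apply/eqP; rewrite -subr_eq0; apply/eqP.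
transitivity (D (x ord_max) * (x ord0 * a + x ord_max * b) -
    x ord_max * (a * D (x ord0) + b * D (x ord_max))); first by ring.
by rewrite -e1 e2 !mulr0 subr0.
Qed.

End AlgebraicOverConstants.

Lemma mmap_mpolyC_X (A : comNzRingType) n (p : {mpoly A[n]}) :
  mmap (@mpolyC n A) (fun i => 'X_i) p = p.
Proof.
elim/mpoly_ring_ind: p => [c|i|p q Hp Hq|p q Hp Hq].
- by rewrite mmapC.
- by rewrite mmapX mmap1U.
- by rewrite mmapD Hp Hq.
- by rewrite rmorphM /= Hp Hq.
Qed.

Section SwapVariables.
Variables (A : idomainType) (n : nat).
Local Notation S := {mpoly A[n]}.

(** A polynomial in q whose coefficients are polynomials in p is read as a
    polynomial in p whose coefficients are polynomials in q. *)
Definition mswap (p : {mpoly S[n]}) : {mpoly S[n]} :=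
  mmap (map_mpoly (@mpolyC n A)) (fun i => ('X_i)%:MP) p.

Lemma mswapD : {morph mswap : p q / p + q}.
Proof. exact: rmorphD. Qed.

Lemma mcoeff_mswap (m : 'X_{1..n}) p :
  (mswap p)@_m = map_mpoly (mcoeff m) p.
Proof.
elim/mpolyind: p => [|c m' p _ _ IH]; first by rewrite /mswap mmap0 !raddf0.
rewrite mswapD mcoeffD [X in _ + X]IH.
transitivity
  (map_mpoly (mcoeff m) (c *: 'X_[m']) + map_mpoly (mcoeff m) p); last first.
  by rewrite raddfD.
congr (_ + _).
rewrite /mswap mmapZ mmapX /mmap1.
have -> : \prod_(i < n) ('X_i)%:MP ^+ m' i = ('X_[m'])%:MP :> {mpoly S[n]}.
  rewrite mpolyXE_id rmorph_prod; apply: eq_bigr => i _.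
  by rewrite rmorphXn.
rewrite mulrC mcoeffCM mcoeff_map_mpoly mulrC /= mul_mpolyC.
apply/mpolyP => m''; rewrite mcoeffZ mcoeff_map_mpoly /= mcoeffZ !mcoeffX.
by case: eqP; rewrite ?mulr1 ?mulr0 ?mcoeff0.
Qed.

Lemma mswapM : {morph mswap : p q / p * q}.
Proof. exact: rmorphM. Qed.

Lemma mswap_eq0 p : (mswap p == 0) = (p == 0).
Proof.
apply/eqP/eqP => [e|->]; last by rewrite /mswap mmap0.
apply/mpolyP => m; rewrite mcoeff0; apply/mpolyP => m'.
have := congr1 (fun q => q@_m'@_m) e.
by rewrite mcoeff_mswap mcoeff_map_mpoly !mcoeff0.
Qed.

Lemma mswap_diagonal p :
  (mswap p).@[fun i => 'X_i] = p.@[fun i => 'X_i].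
Proof.
elim/mpoly_ring_ind: p => [c|i|p q Hp Hq|p q Hp Hq].
- rewrite /mswap mmapC mevalC -mmap_map_mpoly.
  exact: mmap_mpolyC_X.
- by rewrite /mswap mmapX mmap1U mevalC mevalXU.
- by rewrite mswapD !mevalD; congr (_ + _).
- rewrite mswapM (mevalM _ (mswap p)) (mevalM _ p).
  by rewrite [X in X * _]Hp [X in _ * X]Hq.
Qed.

End SwapVariables.

(** * Relations at the generic point *)

Lemma mpoly_elimination (k : fieldType) n (G H : {mpoly k[n.+1]}) :
  irreducible_elt G -> ~ divides G H ->
  exists c U V, c != 0 /\ mwiden c = U * G + V * H.
Proof.
move=> GI nGH.
have gI : irreducible_elt (muni G).
  pose f : {rmorphism {mpoly k[n.+1]} -> {poly {mpoly k[n]}}} := @muni n k.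
  pose g : {rmorphism {poly {mpoly k[n]}} -> {mpoly k[n.+1]}} := @muni_inv k n.
  refine (@irreducible_elt_iso
    {mpoly k[n.+1]} {poly {mpoly k[n]}} f g _ _ G GI).
  - exact: muniK.
  - exact: muni_invK.
have g0 : muni G != 0 by case: gI.
have [sg|/size1_polyC gC] := ltnP 1 (size (muni G)).
  have [|c [u [v [c0 e]]]] :=
    elimination (@factorial_ring_mpoly k n) gI sg (g := muni H).
    move=> [q e]; apply: nGH; exists (muni_inv q).
    by rewrite -[H]muniK e muni_invM muniK.
  exists c, (muni_inv u), (muni_inv v); split=> //.
  transitivity (muni_inv c%:P); first by rewrite muni_invC.
  rewrite e muni_invD; congr (_ + _).
    by rewrite muni_invM; congr (_ * _); apply: muniK.
  by rewrite muni_invM; congr (_ * _); apply: muniK.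
exists (muni G)`_0, 1, 0; split; first by move: g0; rewrite {1}gC polyC_eq0.
by rewrite mul1r mul0r addr0 -muni_invC -gC (muniK G).
Qed.

Lemma mdeg_mnmwiden n (m : 'X_{1..n}) : mdeg (mnmwiden m) = mdeg m.
Proof.
rewrite !mdegE big_ord_recr /= mnmwiden_ordmax addn0.
by apply: eq_bigr => i _; rewrite mnmwiden_widen.
Qed.

Lemma mwiden_pihomog (A : idomainType) n d (p : {mpoly A[n]}) :
  mwiden (pihomog mdeg d p) = pihomog mdeg d (mwiden p).
Proof.
elim/mpolyind: p => [|c m p _ _ IH]; first by rewrite !raddf0.
rewrite pihomogD !mwidenD pihomogD IH; congr (_ + _).
rewrite mwidenZ mwidenX !linearZ /= !pihomogX /= mdeg_mnmwiden.
by case: ifP => _; rewrite ?scaler0 ?mwiden0 // mwidenZ mwidenX.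
Qed.

Lemma mmap_mwiden (k F : comNzRingType) (iota : {rmorphism k -> F}) n
    (x : 'I_n.+1 -> F) (p : {mpoly k[n]}) :
  mmap iota x (mwiden p) = mmap iota (fun i => x (widen_ord (leqnSn n) i)) p.
Proof.
elim/mpoly_ring_ind: p => [c|i|p q Hp Hq|p q Hp Hq].
- by rewrite mwidenC !mmapC.
- by rewrite mwidenX mnmwiden1 !mmapX !mmap1U.
- by rewrite mwidenD !mmapD Hp Hq.
- by rewrite mwidenM !rmorphM /= Hp Hq.
Qed.

(** Prime constants remain prime, so each prime factor of b divides L. *)
Lemma cancel_primitive (A : idomainType) n (G H L : {mpoly A[n]}) k b :
  (forall p, prime_elt p -> ~ divides (p%:MP : {mpoly A[n]}) G) ->
  prime_product k b -> b%:MP * H = L * G -> divides G H.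
Proof.
move=> prim Hb; elim: Hb L => {k b} [u uu|k p b pp _ IH] L e.
  exists ((u^-1)%:MP * L); rewrite -mulrA -e mulrA -mpolyCM mulVr //.
  by rewrite mpolyC1 mul1r.
have [p0 _ pP] := prime_elt_mpolyC n pp.
have [|[L' LE]|/(prim p pp)//] := pP L G.
  by rewrite -e mpolyCM -mulrA mulrC; apply: divides_mull; exact: divides_refl.
apply: (IH L'); apply: (mulfI p0).
by rewrite mulrA -mpolyCM e LE mulrCA mulrA.
Qed.

(** Among the multiples of H with polynomial coefficients, take one for which
    a chosen nonzero coefficient has least degree: dividing by a prime would
    lower this degree. *)
Lemma primitive_multiple (K F : fieldType) r n
    (f : {rmorphism {mpoly K[r]} -> F}) (H : {mpoly F[n]}) :
  injective f -> (forall c, exists u b, b != 0 /\ c * f b = f u) -> H != 0 ->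
  exists a G, [/\ a != 0, map_mpoly f G = a%:MP * H &
    forall p, prime_elt p -> ~ divides (p%:MP : {mpoly {mpoly K[r]}[n]}) G].
Proof.
move=> f_inj f_frac H0.
have f_eq0 a : (f a == 0) = (a == 0) by rewrite -(inj_eq f_inj) rmorph0.
have fC x : map_mpoly f x%:MP_[n] = (f x)%:MP by exact: map_mpolyC.
pose m := mlead H.
have Hm : H@_m != 0 by rewrite mleadc_eq0.
pose Q l := `[< exists a G,
  [/\ a != 0, map_mpoly f G = a%:MP * H & msize G@_m = l] >].
have exQ : exists l, Q l.
  have [a [G [a0 GE]]] := clear_denominators H f_frac.
  by exists (msize G@_m); apply/asboolP; exists (f a), G; rewrite f_eq0.
have [l /asboolP[a [G [a0 GE sG]]] lmin] := ex_minnP exQ.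
exists a, G; split=> // p [p0 pu _] [q qE].
have fp0 : f p != 0 by rewrite f_eq0.
have qF : map_mpoly f q = (a / f p)%:MP * H.
  have pF0 : (f p)%:MP != 0 :> {mpoly F[n]} by rewrite mpolyC_eq0.
  have e : map_mpoly f G = map_mpoly f q * (f p)%:MP.
    by rewrite qE (rmorphM (map_mpoly f) q) /= fC.
  by apply: (mulIf pF0); rewrite -e GE mulrAC -mpolyCM divfK.
have Gm : G@_m = p * q@_m by rewrite qE [q * _]mulrC mcoeffCM.
have Gm0 : G@_m != 0.
  have := congr1 (mcoeff m) GE; rewrite mcoeff_map_mpoly mcoeffCM => e.
  by rewrite -f_eq0 [f _]e mulf_neq0.
have qm0 : q@_m != 0 by apply: contraNneq Gm0 => e; rewrite Gm e mulr0.
have : Q (msize q@_m).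
  apply/asboolP; exists (a / f p), q; split=> //.
  by rewrite mulf_neq0 ?invr_eq0.
move/lmin; rewrite -sG Gm msizeM // leqNgt => /negP[].
have : (1 < msize p)%N.
  rewrite ltnNge; apply: contra pu => /msize1_polyC pC.
  move: p0; rewrite pC mpolyC_eq0 => p0.
  by apply: rmorph_unit; rewrite unitfE.
by case: (msize p) => [|[|s]] // _; rewrite !addSn /= ltnS leq_addl.
Qed.

(** F is the field of rational functions in p = (x, y, z), D the extension of
    X to F and k its field of constants. A polynomial G in q over k is
    evaluated at the generic point p by [ev]; when G is homogeneous, one may
    think of the family of curves G(p, q) = 0 in the plane of q, which passes
    through p and depends only on the leaf of p. [Xk] is X acting on the
    variables q, with coefficients extended from K to k. *)
Section GenericPoint.
Variables (K : fieldType) (X : 'I_3 -> {mpoly K[3]}) (d n : nat).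
Hypothesis char0 : forall m, m.+1%:R != 0 :> K.
Hypothesis hX : forall i, X i \is d.-homog.
Hypothesis n_gt0 : (0 < n)%N.
Hypothesis no_invariant :
  forall e P Q, (e <= n)%N -> ~ rational_invariant X e P Q.

Local Notation S := {mpoly K[3]}.
Variables (F : fieldType) (f : {rmorphism S -> F}) (D : derivation F).
Hypothesis f_inj : injective f.
Hypothesis f_frac : forall c, exists u b, b != 0 /\ c * f b = f u.
Hypothesis D_f : forall a, D (f a) = f (mvf X a).

Local Notation k := (constants D).
Local Notation iota := (constant_incl D).

Let point (i : 'I_3) : F := f 'X_i.
Let ev (p : {mpoly k[3]}) : F := mmap iota point p.
Let XF (i : 'I_3) : {mpoly F[3]} :=
  map_mpoly f (map_mpoly (@mpolyC 3 K) (X i)).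

Let f_eq0 a : (f a == 0) = (a == 0).
Proof. by rewrite -(inj_eq f_inj) rmorph0. Qed.

Let f_constant c : D (f c%:MP) = 0.
Proof. by rewrite D_f mvfC rmorph0. Qed.

Lemma constant_field_exists :
  exists Xk : 'I_3 -> {mpoly k[3]}, forall i, map_mpoly iota (Xk i) = XF i.
Proof.
have /choice[Xk XkE] :
    forall i, exists q : {mpoly k[3]}, map_mpoly iota q = XF i.
  by move=> i; apply: lift_constants => m; rewrite !mcoeff_map_mpoly f_constant.
by exists Xk.
Qed.

Variable Xk : 'I_3 -> {mpoly k[3]}.
Hypothesis XkE : forall i, map_mpoly iota (Xk i) = XF i.

Let char0_k m : m.+1%:R != 0 :> k.
Proof.
rewrite -(fmorph_eq0 iota) rmorph_nat -(rmorph_nat f) f_eq0.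
by rewrite -(rmorph_nat (@mpolyC 3 K)) mpolyC_eq0.
Qed.

Let evM : {morph ev : p q / p * q}.
Proof. exact: rmorphM. Qed.

Let evD : {morph ev : p q / p + q}.
Proof. exact: rmorphD. Qed.

Lemma diagonal_eval (p : {mpoly S[3]}) :
  (map_mpoly f p).@[point] = f p.@[fun i => 'X_i].
Proof.
rewrite -mmap_map_mpoly; elim/mpoly_ring_ind: p => [c|i|p q Hp Hq|p q Hp Hq].
- by rewrite mmapC mevalC.
- by rewrite mmapX mmap1U mevalXU.
- by rewrite mmapD mevalD rmorphD /= Hp Hq.
- by rewrite mevalM !rmorphM /= Hp Hq.
Qed.

Lemma ev_Xk i : ev (Xk i) = f (X i).
Proof.
rewrite /ev mmap_map_mpoly XkE diagonal_eval; congr (f _).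
by rewrite -mmap_map_mpoly mmap_mpolyC_X.
Qed.

Lemma derivation_ev p : D (ev p) = ev (mvf Xk p).
Proof.
rewrite /ev derivation_mmap; last exact: derivation_constant.
rewrite /mvf raddf_sum; apply: eq_bigr => i _ /=.
by rewrite rmorphM /= D_f mvfX -ev_Xk mulrC.
Qed.

Lemma Xk_homog i : Xk i \is d.-homog.
Proof.
have : XF i \is d.-homog by apply/map_mpoly_homog/map_mpoly_homog.
rewrite -XkE => /dhomogP H; apply/dhomogP => m mX; apply: H.
move: mX; rewrite !mcoeff_msupp; rewrite mcoeff_map_mpoly /=.
by rewrite fmorph_eq0.
Qed.

(** A relation between x and y alone forces x / y to be a first integral of
    degree 1. *)
Lemma binary_relation (p : {mpoly k[2]}) e :
  p \is e.-homog -> p != 0 -> ev (mwiden p) = 0 -> False.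
Proof.
move=> hp p0; rewrite /ev mmap_mwiden.
move/(binary_form_zero (derivation_constant (D := D)) char0_k hp p0).
rewrite /point; set i0 := widen_ord _ _; set i1 := widen_ord _ _.
have i10 : i1 != i0 by rewrite -val_eqE.
rewrite !D_f !mvfX -!rmorphM => /f_inj e01.
apply: (no_invariant n_gt0 (P := 'X_i1) (Q := 'X_i0)).
have hom1 i : ('X_i : {mpoly K[3]}) \is 1.-homog by rewrite dhomogX /= mdeg1.
split=> //.
- apply/eqP => /(congr1 (mcoeff U_(i0))); rewrite mcoeffX eqxx mcoeff0.
  by apply/eqP; exact: oner_neq0.
- move=> c /(congr1 (mcoeff U_(i1))); rewrite mcoeffCM !mcoeffX eqxx.
  rewrite eq_mnm1 eq_sym (negPf i10) mulr0; apply/eqP; exact: oner_neq0.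
- by rewrite !vf_applyE !mvfX mulrC e01.
Qed.

(** G is irreducible by minimality, and X G also vanishes at the generic point
    because the coefficients of G are constants. If G did not divide X G, the
    last variable could be eliminated between them, and a homogeneous component
    of the result would be a relation between x and y alone. *)
Lemma minimal_relation_invariant m (G : {mpoly k[3]}) :
  G \is m.-homog -> G != 0 -> ev G = 0 ->
  (forall m' H, (m' < m)%N -> H \is m'.-homog -> H != 0 -> ev H != 0) ->
  exists L, mvf Xk G = L * G.
Proof.
move=> hG G0 evG mmin.
have GI : irreducible_elt G.
  split=> // [|b c bc].
    apply/negP => /mpoly_unitP[c]; rewrite unitfE => c0 GE.
    by move/eqP: evG; rewrite /ev GE mmapC fmorph_eq0 (negPf c0).
  have bc0 : b * c != 0 by rewrite -bc.
  have [i [j [hb hc ij]]] : exists i j,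
      [/\ b \is i.-homog, c \is j.-homog & (i + j)%N = m].
    by apply: homog_factor; rewrite -bc.
  move: (bc0); rewrite mulf_eq0 negb_or => /andP[b0 c0].
  have unit_of (q : {mpoly k[3]}) l l' : q \is l.-homog -> q != 0 ->
      (l' + l)%N = m -> (m <= l')%N -> q \is a GRing.unit.
    move=> hq q0 <-; rewrite -{2}[l']addn0 leq_add2l leqn0 => /eqP l0.
    move: hq q0; rewrite l0 => /homog0C ->; rewrite mpolyC_eq0 => q0.
    by apply: rmorph_unit; rewrite unitfE.
  move/eqP: evG; rewrite bc evM mulf_eq0 => /orP[/eqP eb|/eqP ec].
    right; apply: (unit_of c j i) => //; rewrite leqNgt; apply/negP => lt.
    by case/eqP: (mmin i b lt hb b0).
  left; apply: (unit_of b i j) => //; first by rewrite addnC.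
  rewrite leqNgt; apply/negP => lt.
  by case/eqP: (mmin j c lt hc c0).
have evH : ev (mvf Xk G) = 0 by rewrite -derivation_ev evG derivation0.
have hH := mvf_homog Xk_homog hG.
apply: contrapT => nd; have [c [U [V [c0 cE]]]] := mpoly_elimination GI nd.
have [e ce0 _] := min_homog_component c0.
apply: (binary_relation (pihomogP mdeg e c) ce0).
rewrite mwiden_pihomog cE pihomogD evD.
have [w1 ->] := pihomog_mul_homog e U hG.
have [w2 ->] := pihomog_mul_homog e V hH.
by rewrite !evM evG evH !mulr0 addr0.
Qed.

(** Replace G by a primitive multiple Gp in K[p][q]. The relation X G = L G
    then holds in K[p][q], by Gauss's lemma. Since X acts on q only, it does not
    raise the degree in p, so L has degree 0 in p. Comparing coefficients of
    the monomials in p, all the coefficients of Gp, which are forms of degree m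
    in q, have the same cofactor l. *)
Lemma relation_constant_cofactor m (G L : {mpoly k[3]}) :
  G \is m.-homog -> G != 0 -> mvf Xk G = L * G ->
  exists (a : F) (Gp : {mpoly S[3]}) (l : S),
    [/\ Gp != 0, map_mpoly f Gp = a%:MP * map_mpoly iota G,
        forall i, map_mpoly (mcoeff i) Gp \is m.-homog &
        forall i, mvf X (map_mpoly (mcoeff i) Gp) = l * map_mpoly (mcoeff i) Gp].
Proof.
move=> hG G0 XG.
have GF0 : map_mpoly iota G != 0.
  rewrite -(raddf0 (map_mpoly iota)) (inj_eq (map_mpoly_inj _)) //.
  exact: fmorph_inj.
have [a [Gp [a0 GpE prim]]] := primitive_multiple f_inj f_frac GF0.
have Gp0 : Gp != 0.
  apply: contraNneq (mulf_neq0 (_ : a%:MP_[3] != 0) GF0) => [e|].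
    by rewrite -GpE e raddf0.
  by rewrite mpolyC_eq0.
pose Xp i : {mpoly S[3]} := map_mpoly (@mpolyC 3 K) (X i).
have [b [Lp [b0 LpE]]] := clear_denominators (map_mpoly iota L) f_frac.
have fC x : map_mpoly f x%:MP_[3] = (f x)%:MP by exact: map_mpolyC.
have e : b%:MP * mvf Xp Gp = Lp * Gp.
  apply: (map_mpoly_inj f_inj); rewrite !rmorphM /= fC LpE map_mvf GpE.
  rewrite mvfM mvfC mul0r add0r.
  have -> : mvf (fun i => map_mpoly f (Xp i)) (map_mpoly iota G) =
            map_mpoly iota (mvf Xk G).
    by rewrite map_mvf; apply: eq_bigr => i _; rewrite XkE.
  by rewrite XG rmorphM /=; ring.
have [j Hb] := factorial_ring_mpoly b0.
have [L1 L1E] := cancel_primitive prim Hb e.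
have comp i : map_mpoly (mcoeff i) (mvf Xp Gp) = mvf X (map_mpoly (mcoeff i) Gp).
  rewrite /mvf raddf_sum; apply: eq_bigr => t _; apply/mpolyP => i'.
  rewrite /= mcoeff_map_mpoly !mcoeffM raddf_sum; apply: eq_bigr => u _.
  by rewrite /= !mcoeff_map_mpoly mcoeffCM !mcoeff_deriv mcoeffMn mcoeff_map_mpoly.
have sG0 : mswap Gp != 0 by rewrite mswap_eq0.
have /msize1_polyC L1C : (msize (mswap L1) <= 1)%N.
  have [->|sL0] := eqVneq (mswap L1) 0; first by rewrite msize0.
  have : (msize (mswap (mvf Xp Gp)) <= msize (mswap Gp))%N.
    rewrite [X in (X <= _)%N]msizeE; apply/bigmax_leqP_seq => i + _.
    rewrite mcoeff_msupp mcoeff_mswap comp => nz; apply: msize_mdeg_lt.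
    rewrite mcoeff_msupp mcoeff_mswap; apply: contraNneq nz => ->.
    by rewrite -(mpolyC0 3 K) mvfC.
  have -> : mswap (mvf Xp Gp) = mswap L1 * mswap Gp.
    by rewrite -mswapM; congr (mswap _).
  rewrite (msizeM sL0 sG0).
  by rewrite -subn1 leq_subLR leq_add2r.
exists a, Gp, (mswap L1)@_0; split=> // i.
  apply/dhomogP => i' nz; apply: (dhomog_mf hG).
  move: nz; rewrite !mcoeff_msupp mcoeff_map_mpoly /=; apply: contraNneq => Gi.
  have := congr1 (mcoeff i') GpE.
  rewrite mcoeffCM !mcoeff_map_mpoly Gi raddf0 mulr0 => /eqP.
  by rewrite f_eq0 => /eqP ->; rewrite mcoeff0.
by rewrite -comp L1E -!mcoeff_mswap mswapM {1}L1C mcoeffCM.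
Qed.

(** For m minimal, two coefficients of Gp with the same cofactor have a
    quotient which is invariant, so they are proportional. Then Gp is a product
    T(p) g(q) of nonzero polynomials, and does not vanish on the diagonal
    q = p. *)
Lemma no_relation m (G : {mpoly k[3]}) :
  (m <= n)%N -> G \is m.-homog -> G != 0 -> ev G != 0.
Proof.
elim/ltn_ind: m G => m IH G le_mn hG G0; apply/eqP => evG.
have [L XG] : exists L, mvf Xk G = L * G.
  apply: (minimal_relation_invariant hG G0 evG) => m' H lt hH H0.
  by apply: (IH m') => //; apply: leq_trans (ltnW lt) le_mn.
have [a [Gp [l [Gp0 GpE hGp XGp]]]] := relation_constant_cofactor hG G0 XG.
pose g i : S := map_mpoly (mcoeff i) Gp.
have [i0 gi0] : exists i, g i != 0.
  have : mswap Gp != 0 by rewrite mswap_eq0.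
  by rewrite -mleadc_eq0 mcoeff_mswap; exists (mlead (mswap Gp)).
have /choice[t tE] : forall i, exists t : K, g i = t%:MP * g i0.
  move=> i; apply: contrapT => nt.
  apply: (no_invariant le_mn (P := g i) (Q := g i0)).
  split=> //; try exact: hGp.
    by move=> c e; apply: nt; exists c.
  have XG' j : mvf X (g j) = l * g j by exact: XGp.
  by rewrite !vf_applyE !XG' -mulrA mulrCA.
have : Gp.@[fun i => 'X_i] = 0.
  apply/eqP; rewrite -f_eq0 -diagonal_eval GpE mevalM -mmap_map_mpoly.
  by rewrite -/(ev G) evG mulr0.
rewrite -mswap_diagonal mevalE.
pose T : S := \sum_(i <- msupp (mswap Gp)) t i *: 'X_[i].
have -> : \sum_(i <- msupp (mswap Gp)) (mswap Gp)@_i * \prod_j 'X_j ^+ i j =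
    T * g i0.
  rewrite mulr_suml; apply: eq_bigr => i _.
  rewrite mcoeff_mswap -/(g i) tE -mpolyXE_id -mul_mpolyC; ring.
have ti0 : t i0 != 0.
  by apply: contraNneq gi0 => e; rewrite tE e mpolyC0 mul0r.
move/eqP; rewrite mulf_eq0 (negPf gi0) orbF => /eqP/(congr1 (mcoeff i0)).
rewrite mcoeff0 raddf_sum /= (bigD1_seq i0) ?msupp_uniq //=; last first.
  by rewrite mcoeff_msupp mcoeff_mswap.
rewrite mcoeffZ mcoeffX eqxx mulr1 big1 ?addr0 => [/eqP|i ne].
  by rewrite (negPf ti0).
by rewrite mcoeffZ mcoeffX (negPf ne) mulr0.
Qed.

End GenericPoint.

(** * The extactic determinant *)

Lemma monomials_of_degree n :
  exists mono : 'I_('C(n + 2, n)) -> 'X_{1..3},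
    [/\ injective mono, forall j, mdeg (mono j) = n &
        forall m, mdeg m = n -> exists j, mono j = m].
Proof.
pose B := [seq s2m t | t : n.-tuple 'I_3 <- enum (basis 3 n)].
have sB : size B = 'C(n + 2, n) by exact: size_basis.
have uB : uniq B by exact: uniq_basis.
have cB m : (mdeg m == n) = (m \in B) by exact: basis_cover.
exists (fun j => nth 0%MM B j); split.
- by move=> i j /eqP; rewrite nth_uniq ?sB // => /eqP /val_inj.
- by move=> j; apply/eqP; rewrite cB mem_nth ?sB.
- move=> m /eqP; rewrite cB => mB.
  have lt : (index m B < 'C(n + 2, n))%N by rewrite -sB index_mem.
  by exists (Ordinal lt); rewrite /= nth_index.
Qed.

Lemma binD2 n : 'C(n + 2, n) = 'C(n.+2, 2).
Proof. by rewrite addn2 -(bin_sub (_ : 2 <= n.+2)%N) // subn2. Qed.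

Lemma prod_homog (A : idomainType) n (I : Type) (s : seq I) (e : I -> nat)
    (p : I -> {mpoly A[n]}) :
  (forall i, p i \is (e i).-homog) ->
  \prod_(i <- s) p i \is (\sum_(i <- s) e i)%N.-homog.
Proof.
move=> hp; elim/big_rec2: _ => [|i q k _ IH]; first exact: dhomog1.
exact: dhomogM.
Qed.

Lemma zero_locus_scale (K : fieldType) (c : K) (P : {mpoly K[3]}) :
  c != 0 -> zero_locus (c%:MP * P) = zero_locus P.
Proof.
move=> c0; rewrite /zero_locus; apply/seteqP.
split=> p [pp H]; split=> // v /H; rewrite mevalM mevalC => /eqP.
  by rewrite mulf_eq0 (negPf c0) => /eqP.
by move=> /eqP ->; rewrite mulr0.
Qed.

(** For d = 0 the truncated subtraction makes this differ from the formula
    of the bound, but then the extactic determinant is 0. *)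
Definition extactic_degree d n := (\sum_(r < 'C(n + 2, n)) (n + r * d - r))%N.

Section Extactic.
Variables (K : fieldType) (X : 'I_3 -> {mpoly K[3]}) (d n : nat).
Hypothesis char0 : forall m, m.+1%:R != 0 :> K.
Hypothesis hX : forall i, X i \is d.-homog.
Hypothesis n_gt0 : (0 < n)%N.

Local Notation S := {mpoly K[3]}.
Local Notation N := 'C(n + 2, n).
Variable mono : 'I_N -> 'X_{1..3}.
Hypothesis mono_inj : injective mono.
Hypothesis mdeg_mono : forall j, mdeg (mono j) = n.
Hypothesis mono_onto : forall m, mdeg m = n -> exists j, mono j = m.

(** The determinant of this matrix is the n-th extactic curve: at a point p,
    it vanishes when some curve of degree n meets the trajectory of p to order
    at least the number of its coefficients. *)
Definition extactic_mx : 'M[S]_N :=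
  \matrix_(i < N, j < N) iter i (mvf X) 'X_[mono j].

Local Notation E := (\det extactic_mx).

Lemma iter_mvf_homog i p :
  p \is n.-homog -> iter i (mvf X) p \is (n + i * d - i).-homog.
Proof.
move=> hp; elim: i => [|i IH]; first by rewrite mul0n addn0 subn0.
have -> : (n + i.+1 * d - i.+1 = (n + i * d - i) + d - 1)%N.
  by clear n_gt0; case: d => [|d']; rewrite ?muln0 ?mulnS; lia.
exact: (mvf_homog hX).
Qed.

Lemma extactic_homog : E \is (extactic_degree d n).-homog.
Proof.
rewrite /determinant; apply: rpred_sum => s _.
rewrite rpredMsign; apply: prod_homog => i.
by rewrite mxE; apply: iter_mvf_homog; rewrite dhomogX /= mdeg_mono.
Qed.

(** A field with constant coefficients kills the forms of degree n after
    n + 1 steps, and the matrix has more than n + 1 rows. *)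
Lemma extactic_degree0 : d = 0%N -> E = 0.
Proof.
move=> d0; have N1 : (n.+1 < N)%N.
  by rewrite binD2 -bin2_sum big_nat_recr //= big_nat_recr //=; lia.
rewrite /determinant big1 // => s _; apply/eqP.
rewrite mulf_eq0; apply/orP; right.
rewrite (bigD1 (Ordinal N1)) //= mxE /=.
have h : iter n (mvf X) 'X_[mono (s (Ordinal N1))] \is 0.-homog.
  have := @iter_mvf_homog n 'X_[mono (s (Ordinal N1))].
  by rewrite d0 muln0 addn0 subnn; apply; rewrite dhomogX /= mdeg_mono.
by rewrite (homog0C h) mvfC mul0r.
Qed.

Lemma homog_expansion (A : nzRingType) (p : {mpoly A[3]}) : p \is n.-homog ->
  p = \sum_j p@_(mono j) *: 'X_[mono j].
Proof.
move=> hp; apply/mpolyP => m; rewrite raddf_sum /=.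
have [/mono_onto[j <-]|ne] := eqVneq (mdeg m) n.
  rewrite (bigD1 j) //= mcoeffZ mcoeffX eqxx mulr1 big1 ?addr0 // => i ij.
  by rewrite mcoeffZ mcoeffX (inj_eq mono_inj) (negPf ij) mulr0.
rewrite (dhomog_nemf_coeff hp ne) big1 // => j _.
rewrite mcoeffZ mcoeffX; case: eqP => [e|]; last by rewrite mulr0.
by rewrite -e mdeg_mono eqxx in ne.
Qed.

Lemma iter_mvf_sum i (a : 'I_N -> K) :
  iter i (mvf X) (\sum_j a j *: 'X_[mono j]) =
  \sum_j a j *: iter i (mvf X) 'X_[mono j].
Proof.
elim: i => //= i ->; rewrite mvf_sum.
by apply: eq_bigr => j _; rewrite mvfZ.
Qed.

Lemma iter_mvf_invariant P Q L i : mvf X P = L * P ->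
  exists W, iter i (mvf X) (P * Q) = P * W.
Proof.
move=> hP; elim: i => [|i [W e]]; first by exists Q.
by exists (L * W + mvf X W); rewrite /= e mvfM hP; ring.
Qed.

(** Complete P to a form of degree n by a power of a coordinate. All the
    iterated images of this form under X are multiples of P, so a combination
    of the columns of the matrix, with coefficients in K, is divisible by P;
    the adjugate matrix transfers this to the determinant. *)
Lemma invariant_divides_extactic P L i :
  P != 0 -> P \is i.-homog -> (i <= n)%N -> mvf X P = L * P -> divides P E.
Proof.
move=> P0 hP le_in XP.
pose M : S := 'X_[(U_(ord0) *+ (n - i))%MM].
have hM : M \is (n - i).-homog by rewrite dhomogX /= mdegMn mdeg1 mul1n.
have M0 : M != 0.
  apply/eqP => /(congr1 (mcoeff (U_(ord0) *+ (n - i))%MM)).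
  by rewrite mcoeffX eqxx mcoeff0; apply/eqP; exact: oner_neq0.
have hPM : P * M \is n.-homog by rewrite -(subnKC le_in); apply: dhomogM.
pose a j := (P * M)@_(mono j).
have aE : P * M = \sum_j a j *: 'X_[mono j] by exact: homog_expansion.
have [j0 aj0] : exists j, a j != 0.
  apply: contrapT => na; have : P * M != 0 by rewrite mulf_neq0.
  rewrite aE big1 ?eqxx // => j _.
  have [->|aj] := eqVneq (a j) 0; first by rewrite scale0r.
  by case: na; exists j.
have /choice[W WE] : forall r, exists W, iter r (mvf X) (P * M) = P * W.
  by move=> r; apply: iter_mvf_invariant XP.
pose va : 'cV[S]_N := \col_j (a j)%:MP.
have EW : extactic_mx *m va = P *: \col_r W r.
  apply/matrixP => r c; rewrite !mxE -WE aE iter_mvf_sum.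
  by apply: eq_bigr => j _; rewrite !mxE mulrC mul_mpolyC.
have : E *: va = P *: (\adj extactic_mx *m \col_r W r).
  by rewrite scalemxAr -EW mulmxA mul_adj_mx mul_scalar_mx.
move/matrixP => /(_ j0 0); rewrite !mxE => e.
apply: (@divides_unitr _ (a j0)%:MP).
  by apply: rmorph_unit; rewrite unitfE.
by rewrite mulrC e mulrC; apply: divides_mull; exact: divides_refl.
Qed.

(** A Wronskian which vanishes gives a relation of degree n with constant
    coefficients between the coordinates of the generic point. *)
Lemma extactic_neq0 :
  (forall e P Q, (e <= n)%N -> ~ rational_invariant X e P Q) -> E != 0.
Proof.
move=> ninv; apply/eqP => E0.
have [F [f [D [f_inj f_frac D_f]]]] : exists (F : fieldType)
    (f : {rmorphism S -> F}) (D : derivation F),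
    [/\ injective f, forall c, exists u b, b != 0 /\ c * f b = f u
       & forall a, D (f a) = f (mvf X a)].
  have [D DE] := fraction_deriv_exists (mvf_derivation X).
  exists {fraction S}, (@FracField.tofrac S), D; split=> //.
    by move=> a b /eqP; rewrite tofrac_eq => /eqP.
  by move=> c; have [u [b ?]] := fraction_repr c; exists u, b.
have iterf i a : iter i D (f a) = f (iter i (mvf X) a).
  by elim: i => //= i ->.
have [|c [[j0 cj0] Dc cE]] :=
  wronskian_dependent (D := D) (v := fun j => f 'X_[mono j]).
  rewrite -(rmorph0 f) -E0 -det_map_mx; congr (\det _).
  by apply/matrixP => i j; rewrite !mxE iterf.
have /choice[c' c'E] := fun j => constant_incl_onto (Dc j).
pose G : {mpoly (constants D)[3]} := \sum_j c' j *: 'X_[mono j].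
have [Xk XkE] := constant_field_exists D_f.
have Gj0 : G@_(mono j0) = c' j0.
  rewrite /G raddf_sum (bigD1 j0) //= mcoeffZ mcoeffX eqxx mulr1.
  rewrite big1 ?addr0 // => i ij.
  by rewrite mcoeffZ mcoeffX (inj_eq mono_inj) (negPf ij) mulr0.
have G0 : G != 0.
  apply: contraNneq cj0 => e; move: Gj0; rewrite e mcoeff0 -c'E => <-.
  by rewrite rmorph0.
have hG : G \is n.-homog.
  by apply: rpred_sum => j _; apply: rpredZ; rewrite dhomogX /= mdeg_mono.
have := no_relation char0 hX n_gt0 ninv f_inj f_frac D_f XkE (leqnn n) hG G0.
move/eqP; apply; rewrite raddf_sum -[RHS]cE; apply: eq_bigr => j _ /=.
rewrite mmapZ mmapX c'E; congr (_ * _).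
by rewrite mpolyXE_id rmorph_prod; apply: eq_bigr => i _; rewrite rmorphXn.
Qed.

End Extactic.

(** * Counting invariant curves *)

Section CountingCurves.
Variables (K : fieldType) (X : 'I_3 -> {mpoly K[3]}) (d n : nat).
Hypothesis char0 : forall m, m.+1%:R != 0 :> K.
Hypothesis hX : forall i, X i \is d.-homog.
Hypothesis n_gt0 : (0 < n)%N.
Hypothesis no_invariant :
  forall e P Q, (e <= n)%N -> ~ rational_invariant X e P Q.

Local Notation plane_set := (set {vspace 'rV[K]_3}).

(** The quotient is a nonzero scalar. *)
Lemma divides_irreducible_zero_locus (P Q : {mpoly K[3]}) i j :
  P \isn't a GRing.unit -> P \is i.-homog -> Q \is j.-homog ->
  irreducible_mpoly Q -> divides P Q -> i = j /\ zero_locus P = zero_locus Q.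
Proof.
move=> Pu hP hQ [Q0 _ QI] [c QE].
have [/mpoly_unitP[u + cE]|Pu'] := QI _ _ QE; last by rewrite Pu' in Pu.
rewrite unitfE => u0.
have uP : u%:MP * P != 0 by rewrite -cE -QE.
split; last by rewrite QE cE zero_locus_scale.
apply: (dhomog_uniq Q0) hQ; rewrite QE cE mul_mpolyC.
exact: dhomogZ.
Qed.

(** The invariant curves in C i have equations which are pairwise
    non-associated primes dividing the extactic determinant, so their product
    divides it. Bounding arbitrary finite families C also gives finiteness. *)
Lemma invariant_curves_bound (C : nat -> {fset plane_set}) :
  (forall i Z, (1 <= i <= n)%N -> Z \in C i -> invariant_curves X i Z) ->
  (0 < d)%N /\ (\sum_(1 <= i < n.+1) i * #|` C i| <= extactic_degree d n)%N.
Proof.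
move=> HC; have [mono [mono_inj mdeg_mono mono_onto]] := monomials_of_degree n.
have E0 := extactic_neq0 char0 hX n_gt0 mono_inj mdeg_mono no_invariant.
have hE := extactic_homog hX mdeg_mono.
split.
  rewrite lt0n; apply: contraNneq E0.
  by move=> /(extactic_degree0 hX n_gt0 mdeg_mono) ->.
pose good (t : nat * plane_set) F := [/\ F \is t.1.-homog, irreducible_mpoly F,
   invariant_eq X F & t.2 = zero_locus F].
have /choice[F FP] : forall t, exists F, (exists F', good t F') -> good t F.
  move=> t; have [[F' ?]|n'] := pselect (exists F', good t F').
    by exists F'.
  by exists 0 => /n'.
pose s := [seq (i, Z) | i <- index_iota 1 n.+1, Z <- C i].
have sP t : t \in s -> (1 <= t.1 <= n)%N /\ good t (F t).
  case/allpairsPdep => i [Z [iI ZC ->]] /=.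
  move: iI; rewrite mem_index_iota ltnS => iI; split=> //.
  by apply: FP; have [F' ?] := HC i Z iI ZC; exists F'.
have us : uniq s.
  apply: allpairs_uniq_dep => [|i _|[i Z] [i' Z'] _ _ /= [-> ->] //].
    exact: iota_uniq.
  exact: fset_uniq.
have [q qE] : divides (\prod_(t <- s) F t) (\det (extactic_mx X mono)).
  apply: prod_divides => //.
  - move=> t /sP[_ [_ [F0 Fu FI] _ _]].
    by apply: (irreducible_prime (factorial_ring_mpoly (n := 3))); split.
  - move=> t /sP[/andP[_ le_tn] [hF [F0 _ _] [L FL] _]].
    exact: (invariant_divides_extactic
      mono_inj mdeg_mono mono_onto F0 hF le_tn FL).
  - move=> [i Z] [i' Z'] /sP[_ [hF [_ Fu _] _ /= ZE]].
    move=> /sP[_ [hF' FI' _ /= ZE']] /eqP ne.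
    move/(divides_irreducible_zero_locus Fu hF hF' FI') => /= [ii' zz].
    by apply: ne; rewrite ii' ZE ZE' zz.
have hprod : \prod_(t <- s) F t \is (\sum_(t <- s) t.1)%N.-homog.
  rewrite big_seq [X in X.-homog]big_seq.
  elim/big_rec2: _ => [|t k p /sP[_ [hF _ _ _]] IH]; first exact: dhomog1.
  exact: dhomogM.
have [i [j [_ hj ij]]] : exists i j, [/\ q \is i.-homog,
    \prod_(t <- s) F t \is j.-homog & (i + j)%N = extactic_degree d n].
  by apply: homog_factor; rewrite -qE.
have prod0 : \prod_(t <- s) F t != 0.
  by apply: contraNneq E0 => e; rewrite qE e mulr0.
rewrite -ij -(dhomog_uniq prod0 hprod hj).
apply: leq_trans (leq_addl _ _); rewrite /s big_allpairs_dep.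
apply: leq_sum => l _ /=; rewrite big_const_seq count_predT iter_addn addn0.
by rewrite mulnC leqnn.
Qed.

Lemma finite_invariant_curves i :
  (1 <= i <= n)%N -> finite_set (invariant_curves X i).
Proof.
move=> iI; apply: contrapT => /infinite_set_fset inf.
have [B BX Bcard] := inf (extactic_degree d n).+1.
pose C j := if j == i then B else fset0%fset.
have [|_] := @invariant_curves_bound C.
  by move=> j Z _; rewrite /C; case: eqVneq => [->|]; [apply: BX | rewrite inE].
rewrite (bigD1_seq i) ?iota_uniq ?mem_index_iota //= /C eqxx.
rewrite leqNgt => /negP[]; apply: leq_trans Bcard _.
apply: leq_trans (leq_addr _ _); apply: leq_pmull.
by case/andP: iI.
Qed.

End CountingCurves.

Lemma extactic_degreeE (d n : nat) : (0 < d)%N ->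
  (extactic_degree d n)%:R =
    (d%:R * (n%:R ^+ 4 + 6 * n%:R ^+ 3 + 11 * n%:R ^+ 2 + 6 * n%:R)
     - n%:R ^+ 4 - 2 * n%:R ^+ 3 + n%:R ^+ 2 + 2 * n%:R) / 8 :> rat.
Proof.
case: d => // d _; set N := 'C(n + 2, n).
have -> : extactic_degree d.+1 n = (N * n + 'C(N, 2) * d)%N.
  rewrite /extactic_degree -bin2_sum big_mkord big_distrl /=.
  rewrite -[X in (X * n)%N]card_ord -sum_nat_const -big_split /=.
  by apply: eq_bigr => r _; rewrite mulnS addnCA addKn.
have bin2E m : (2 * 'C(m, 2) + m = m * m)%N.
  have := bin_ffact m 2.
  rewrite !ffactnS ffactn0 muln1 (_ : 2`! = 2%N) // mulnC => ->.
  by case: m => // m; rewrite -mulnSr.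
have NE : (2 * N = (n + 2) * (n + 1))%N.
  by have := bin2E n.+2; rewrite /N binD2; nia.
have NQ : N%:R = (n%:R + 2) * (n%:R + 1) / 2 :> rat.
  apply: (mulfI (_ : 2 != 0)) => //.
  by rewrite -[LHS]natrM NE natrM !natrD; field.
have BQ : 'C(N, 2)%:R = (N%:R * N%:R - N%:R) / 2 :> rat.
  apply: (mulfI (_ : 2 != 0)) => //; rewrite -natrM -(bin2E N) natrD natrM.
  by field.
by rewrite natrD !natrM BQ NQ -[in RHS]addn1 natrD; field.
Qed.

Theorem proposition2 (R : realType) (d n : nat) (X : 'I_3 -> {mpoly R[i][3]})
    (hX : homogeneous_vf d X) (hn : (0 < n)%N)
    (hfi : ~ exists e : nat, (e <= n)%N /\ has_first_integral X e) :
  (forall i : nat, (1 <= i <= n)%N -> finite_set (invariant_curves X i)) /\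
  ((\sum_(1 <= i < n.+1) i * nb_invariant_curves X i)%N%:R : rat) <=
    (d%:R * (n%:R ^+ 4 + 6 * n%:R ^+ 3 + 11 * n%:R ^+ 2 + 6 * n%:R)
     - n%:R ^+ 4 - 2 * n%:R ^+ 3 + n%:R ^+ 2 + 2 * n%:R) / 8.
Proof.
have [hom _] := hX.
have char0 m : m.+1%:R != 0 :> R[i] by rewrite pnatr_eq0.
have ninv e P Q : (e <= n)%N -> ~ rational_invariant X e P Q.
  move=> le_en /rational_invariant_first_integral[e' [le_e fi]].
  by apply: hfi; exists e'; split=> //; apply: leq_trans le_en.
have fin i : (1 <= i <= n)%N -> finite_set (invariant_curves X i).
  exact: (finite_invariant_curves char0 hom hn ninv).
split=> //.
have [i Z iI|d_gt0 le] := invariant_curves_bound char0 hom hn ninv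
  (C := fun i => fset_set (invariant_curves X i)).
  by rewrite in_fset_set ?inE //; apply: fin.
by rewrite -extactic_degreeE // ler_nat.
Qed.
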